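(* Let $K$ be an algebraically closed field of characteristic $p>0$ and let $G$ be a reductive linear algebraic group with $\mathrm{SL}_2(K)\subseteq G\subseteq \mathrm{GL}_2(K)$. Then there exists a $G$-module $V$ of dimension $7p-2$ such that the invariant ring $K[V]^G$ is not Cohen-Macaulay. Moreover, $V$ can be chosen such that there are a $1$-cocycle $g\in Z^1(G,K[V]_2)$ whose class in $H^1(G,K[V])$ is nonzero, and invariants $a_1,a_2,a_3\in K[V]_1^G$ forming a partial homogeneous system of parameters and annihilating $g$, i.e. $a_ig=0$ in $H^1(G,K[V])$ for $i=1,2,3$ (so the nontrivial cocycle lies in degree $2$ and the annihilating phsop lies in degree $1$).
   Context: A $G$-module is a finite-dimensional $K$-vector space with a linear algebraic (rational) action of $G$, i.e. given by matrices whose entries are regular functions on $G$. For a $G$-module $V$, $K[V]=S(V^* )=\bigoplus_{d\ge 0}S^d(V^* )$ is the polynomial ring on $V$, with the induced $G$-action by graded algebra automorphisms, $K[V]_d=S^d(V^* )$, and $K[V]^G$ is its ring of invariants. A $1$-cocycle with values in a $G$-module $M$ is a morphism of varieties $g:G\to M$, $\sigma\mapsto g_\sigma$, with $g_{\sigma\tau}=\sigma(g_\tau)+g_\sigma$; it is a coboundary if $g_\sigma=(\sigma-1)v$ for some $v\in M$ and all $\sigma\in G$. $Z^1(G,M)$ is the group of cocycles, $H^1(G,M)$ the quotient of cocycles by coboundaries. The same definitions are used for $K[V]$. For an invariant $a\in K[V]^G$ and a cocycle $g$ in $K[V]$, $ag$ denotes the (class of the) cocycle $\sigma\mapsto a\,g_\sigma$.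 For a noetherian connected graded commutative domain $R$ over $K$ ($R_0=K$), a homogeneous system of parameters (hsop) is a set of homogeneous algebraically independent elements $f_1,\dots,f_n$ such that $R$ is a finitely generated module over $K[f_1,\dots,f_n]$; a partial hsop (phsop) is a set that can be extended to an hsop. $R$ is Cohen-Macaulay if it is free as a module over $K[f_1,\dots,f_n]$ for one (equivalently every) hsop. For $G$ reductive, a set of invariants that is a phsop in $K[V]$ is also a phsop in $K[V]^G$; here phsop means in $K[V]$ (hence also in $K[V]^G$). *)

(* Defs.v *)
From mathcomp Require Export all_boot all_order all_algebra.
From mathcomp Require Export mpoly.

Set Implicit Arguments.
Unset Strict Implicit.
Unset Printing Implicit Defensive.

Import GRing.Theory.
Local Open Scope ring_scope.

Section AlgebraicGroups.

Variables (K : closedFieldType) (m : nat).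

Implicit Types (G H U X A B : 'M[K]_m -> Prop) (s t : 'M[K]_m).

Definition meval_mx (q : {mpoly K[m * m]}) s : K := q.@[fun i => mxvec s 0 i].

Definition zariski_closed_GL X : Prop :=
  exists S : {mpoly K[m * m]} -> Prop,
    forall s, X s <-> s \in unitmx /\ forall q, S q -> meval_mx q s = 0.

Definition closed_subgroup_GL G : Prop :=
  [/\ zariski_closed_GL G,
      G 1%:M,
      forall s t, G s -> G t -> G (s *m t)
    & forall s, G s -> G (invmx s)].

(* The coordinate ring of a closed subset of GL_m is generated by the matrix
   entries and 1/det. *)
Definition regular_on G (f : 'M[K]_m -> K) : Prop :=
  exists (q : {mpoly K[m * m]}) (k : nat),
    forall s, G s -> f s = meval_mx q s / \det s ^+ k.

Definition zariski_connected X : Prop :=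
  forall A B, zariski_closed_GL A -> zariski_closed_GL B ->
    (forall s, X s -> A s \/ B s) ->
    (forall s, X s -> ~ (A s /\ B s)) ->
    (forall s, X s -> A s) \/ (forall s, X s -> B s).

Definition unipotent U : Prop :=
  forall s, U s -> exists k : nat, (s - 1%:M) ^+ k = 0.

Definition normal_in U G : Prop :=
  (forall s, U s -> G s) /\
  (forall s t, G s -> U t -> U (s *m t *m invmx s)).

(* The unipotent radical is the largest closed connected normal unipotent
   subgroup, so its triviality means that every such subgroup is trivial. *)
Definition reductive G : Prop :=
  forall U, closed_subgroup_GL U -> normal_in U G ->
    zariski_connected U -> unipotent U -> forall s, U s -> s = 1%:M.

End AlgebraicGroups.

Section GradedAlgebras.

(* A graded subalgebra of K[x_1, ..., x_n] is given by its membership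
   predicate [R]; [{mpoly K[n]}] itself is [fun _ => True]. *)
Variables (K : closedFieldType) (n : nat).

Implicit Types R : {mpoly K[n]} -> Prop.

Definition alg_independent k (f : k.-tuple {mpoly K[n]}) : Prop :=
  forall P : {mpoly K[k]}, P \mPo f = 0 -> P = 0.

(* The elements of K[f_1, ..., f_k] are the [P \mPo f]. *)
Definition finite_module_over R k (f : k.-tuple {mpoly K[n]}) : Prop :=
  exists2 h : seq {mpoly K[n]}, (forall b, b \in h -> R b) &
    forall r, R r -> exists c : {mpoly K[n]} -> {mpoly K[k]},
      r = \sum_(b <- h) (c b \mPo f) * b.

Definition free_module_over R k (f : k.-tuple {mpoly K[n]}) : Prop :=
  exists B : {mpoly K[n]} -> Prop,
    [/\ forall b, B b -> R b,
        forall r, R r ->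
          exists (s : seq {mpoly K[n]}) (c : {mpoly K[n]} -> {mpoly K[k]}),
            (forall b, b \in s -> B b) /\ r = \sum_(b <- s) (c b \mPo f) * b
      & forall (s : seq {mpoly K[n]}) (c : {mpoly K[n]} -> {mpoly K[k]}),
          uniq s -> (forall b, b \in s -> B b) ->
          \sum_(b <- s) (c b \mPo f) * b = 0 ->
          forall b, b \in s -> c b \mPo f = 0].

Definition hsop R k (f : k.-tuple {mpoly K[n]}) : Prop :=
  [/\ forall i, R (tnth f i),
      forall i, exists d : nat, tnth f i \is d.-homog,
      alg_independent f
    & finite_module_over R f].

Definition partial_hsop R k (a : k.-tuple {mpoly K[n]}) : Prop :=
  exists (l : nat) (b : l.-tuple {mpoly K[n]}), hsop R [tuple of a ++ b].

Definition cohen_macaulay R : Prop :=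
  exists (k : nat) (f : k.-tuple {mpoly K[n]}),
    hsop R f /\ free_module_over R f.

End GradedAlgebras.

Section Modules.

Variables (K : closedFieldType) (m n : nat).
Variables (G : 'M[K]_m -> Prop) (rho : 'M[K]_m -> 'M[K]_n).

(* A G-module of dimension n, in coordinates: s in G acts on V = K^n by
   v |-> rho s *m v.  The values of rho outside G are irrelevant. *)
Definition Gmodule : Prop :=
  [/\ rho 1%:M = 1%:M,
      forall s t, G s -> G t -> rho (s *m t) = rho s *m rho t
    & forall i j, regular_on G (fun s => rho s i j)].

(* The action on K[V] = S(V^* ): (s f)(v) = f(s^-1 v), where 'X_i is the i-th
   coordinate function on V. *)
Definition poly_act (s : 'M[K]_m) (f : {mpoly K[n]}) : {mpoly K[n]} :=
  f \mPo [tuple \sum_(j < n) rho (invmx s) i j *: 'X_j | i < n].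

Definition invariant_ring (f : {mpoly K[n]}) : Prop :=
  forall s, G s -> poly_act s f = f.

(* A morphism from G to the infinite-dimensional space K[V] is a morphism to a
   finite-dimensional subspace. *)
Definition morphism_to_KV (g : 'M[K]_m -> {mpoly K[n]}) : Prop :=
  (exists d : nat, forall s, G s -> (msize (g s) <= d)%N) /\
  (forall mon : 'X_{1..n}, regular_on G (fun s => (g s)@_mon)).

Definition cocycle (g : 'M[K]_m -> {mpoly K[n]}) : Prop :=
  morphism_to_KV g /\
  (forall s t, G s -> G t -> g (s *m t) = poly_act s (g t) + g s).

Definition cocycle_deg (d : nat) (g : 'M[K]_m -> {mpoly K[n]}) : Prop :=
  cocycle g /\ (forall s, G s -> g s \is d.-homog).

(* For a cocycle g: its class in H^1(G, K[V]) is zero. *)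
Definition coboundary (g : 'M[K]_m -> {mpoly K[n]}) : Prop :=
  exists v : {mpoly K[n]}, forall s, G s -> g s = poly_act s v - v.

End Modules.

(* Main.v *)
From HB Require Import structures.
Require Import Defs.
From mathcomp Require Import perm ring zify.

(** Let F be the Frobenius twist of the natural module and A the submodule
    spanned by the middle monomials in the p-th (divided) power extension of F
    by A.  This extension gives a nonzero class g in H^1(G, Hom(F, A)), which
    vanishes in H^1(G, M) for the extension M of K by Hom(F, A) it defines.  On
    V = F + A^* + 3 M the class g becomes quadratic, the projections M -> K are
    invariant linear forms a_1, a_2, a_3, and a_i g is the coboundary of b_i.

    If K[V]^G were Cohen-Macaulay, a_3 could not be a zero divisor modulo
    (a_1, a_2), so the invariant u = a_1 b_2 - a_2 b_1, which satisfies
    a_3 u = a_1 (a_3 b_2 - a_2 b_3) + a_2 (a_1 b_3 - a_3 b_1), would lie in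
    (a_1, a_2) K[V]^G, and g would be a coboundary.  This needs the ideal
    (a_1, a_2, a_3) of K[V]^G to have height 3.  By counting monomials and Noether
    normalization, some elements of K[V]^G in (a_1, a_2, a_3) K[V] form a regular
    sequence of length 3 in the ring generated by an hsop; powers of them lie in
    (a_1, a_2, a_3) K[V]^G by geometric reductivity.

    Geometric reductivity is explicit: for f invariant under the torus, the
    translate s f, s in SL_2, is a bilinear form E(f) in the degree q - 1
    monomials of the two columns of s, for any large power q of p.  The
    determinant of E(f) is invariant, it depends polynomially on f, and it is
    f^q up to sign when f is invariant, since det(s)^(q-1) then has all its
    coefficients equal to 1 as a form in s_00 s_11 and s_01 s_10. *)

Set Implicit Arguments.
Unset Strict Implicit.
Unset Printing Implicit Defensive.

Import GRing.Theory.
Local Open Scope ring_scope.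

(** * Regular sequences *)

Section RegularSequences.

Variable S : idomainType.
Implicit Types (R : S -> Prop) (a b c : S).

Definition subring R : Prop :=
  [/\ R 1, forall x y, R x -> R y -> R (x - y) & forall x y, R x -> R y -> R (x * y)].

Lemma subring0 R : subring R -> R 0.
Proof. by case=> R1 RB _; rewrite -(subrr 1); apply: RB. Qed.

Lemma subringN R x : subring R -> R x -> R (- x).
Proof. by move=> sR Rx; rewrite -sub0r; case: (sR) => _ RB _; apply: RB (subring0 sR) Rx. Qed.

Lemma subringD R x y : subring R -> R x -> R y -> R (x + y).
Proof.
move=> sR Rx Ry; rewrite -[y]opprK; case: (sR) => _ RB _.
exact: RB Rx (subringN sR Ry).
Qed.

Lemma subringM R x y : subring R -> R x -> R y -> R (x * y).
Proof. by case=> _ _; apply. Qed.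

Lemma subringB R x y : subring R -> R x -> R y -> R (x - y).
Proof. by case=> _ RB _; apply: RB. Qed.

Lemma subringX R x k : subring R -> R x -> R (x ^+ k).
Proof.
move=> sR Rx; elim: k => [|k IH]; first by rewrite expr0; case: sR.
by rewrite exprS; apply: subringM.
Qed.

Lemma subring_sum R (I : Type) (r : seq I) (P : pred I) (F : I -> S) :
  subring R -> (forall i, P i -> R (F i)) -> R (\sum_(i <- r | P i) F i).
Proof.
move=> sR RF; apply: big_ind => //; first exact: subring0.
by move=> x y; apply: subringD.
Qed.

(** Multiplication by [a] is injective on [R / b R]; mind the order, the regular sequence meant is
    [b, a]. Likewise [regular_mod_pair] concerns [c] on [R / (a, b)]. *)
Definition regular_pair R a b : Prop :=
  forall x y, R x -> R y -> a * x = b * y -> exists2 z, R z & x = b * z.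

Definition regular_mod_pair R a b c : Prop :=
  forall x y z, R x -> R y -> R z -> c * z = a * x + b * y ->
  exists x' y', [/\ R x', R y' & z = a * x' + b * y'].

(* If [p1, p2, p3] annihilate [u] modulo [(a1, a2)], then [u] yields a class in
   the second Koszul homology of [p1, p2, p3] (the elements [z_ij] below), and
   its vanishing means that [u] is in [(a1, a2)]. *)
Lemma regular_pair_unmixed R a1 a2 p1 p2 p3 u : subring R ->
  R a1 -> R a2 -> R p1 -> R p2 -> R p3 -> R u ->
  a1 != 0 -> a2 != 0 -> p1 != 0 ->
  regular_pair R a1 a2 -> regular_pair R p2 p1 -> regular_mod_pair R p1 p2 p3 ->
  (forall p, p \in [:: p1; p2; p3] ->
     exists x y, [/\ R x, R y & p * u = a1 * x + a2 * y]) ->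
  exists x y, [/\ R x, R y & u = a1 * x + a2 * y].
Proof.
move=> sR Ra1 Ra2 Rp1 Rp2 Rp3 Ru a1n a2n p1n rega regp regp3 Hu.
(* Eliminating [u] from two of the relations gives [a1 (q x - p x') = a2 (p y' - q y)]; regularity
   of [a1] modulo [a2] yields the common factor [z]. *)
have z_of p q x y x' y' : R p -> R q -> R x -> R y -> R x' -> R y' ->
    p * u = a1 * x + a2 * y -> q * u = a1 * x' + a2 * y' ->
    exists z, [/\ R z, q * x - p * x' = a2 * z & p * y' - q * y = a1 * z].
  move=> Rp Rq Rx Ry Rx' Ry' Ep Eq.
  have E : a1 * (q * x - p * x') = a2 * (p * y' - q * y).
    have -> : a1 * (q * x - p * x') = q * (a1 * x) - p * (a1 * x') by ring.
    have -> : a1 * x = p * u - a2 * y by rewrite Ep addrK.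
    have -> : a1 * x' = q * u - a2 * y' by rewrite Eq addrK.
    by ring.
  have [||z Rz Ez] := rega _ _ _ _ E; try by apply: subringB => //; apply: subringM.
  exists z; split=> //; apply: (mulfI a2n).
  by rewrite -E Ez mulrCA.
have [|x1 [y1 [Rx1 Ry1 E1]]] := Hu p1; first by rewrite inE eqxx.
have [|x2 [y2 [Rx2 Ry2 E2]]] := Hu p2; first by rewrite !inE eqxx orbT.
have [|x3 [y3 [Rx3 Ry3 E3]]] := Hu p3; first by rewrite !inE eqxx !orbT.
have [z12 [Rz12 Ex12 Ey12]] := z_of _ _ _ _ _ _ Rp1 Rp2 Rx1 Ry1 Rx2 Ry2 E1 E2.
have [z13 [Rz13 Ex13 _]] := z_of _ _ _ _ _ _ Rp1 Rp3 Rx1 Ry1 Rx3 Ry3 E1 E3.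
have [z23 [Rz23 Ex23 _]] := z_of _ _ _ _ _ _ Rp2 Rp3 Rx2 Ry2 Rx3 Ry3 E2 E3.
(* The [z_ij] form a Koszul cycle; since [p3] is regular modulo [(p1, p2)], the component [z12] is a
   combination of [p1] and [p2]. *)
have Ez : p3 * z12 = p1 * (- z23) + p2 * z13.
  apply: (mulfI a2n).
  have -> : a2 * (p3 * z12) = p3 * (a2 * z12) by ring.
  have -> : a2 * (p1 * - z23 + p2 * z13) = p2 * (a2 * z13) - p1 * (a2 * z23) by ring.
  by rewrite -Ex12 -Ex13 -Ex23; ring.
have [|w1 [w2 [Rw1 Rw2 Ew]]] := regp3 _ _ _ _ Rz13 Rz12 Ez; first exact: subringN.
(* The correction by [w2] leaves the sum [p1 u] unchanged and makes both coefficients divisible by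
   [p1], because [p2] is regular modulo [p1]; the quotients are coefficients for [u]. *)
have [|||x' Rx' Ex'] := regp (x1 - a2 * w2) (x2 + a2 * w1).
- by apply: subringB => //; apply: subringM.
- by apply: subringD => //; apply: subringM.
- have -> : p2 * (x1 - a2 * w2) = (p2 * x1 - p1 * x2) + p1 * x2 - p2 * a2 * w2 by ring.
  by rewrite Ex12 Ew; ring.
have [|||y' Ry' Ey'] := regp (y1 + a1 * w2) (y2 - a1 * w1).
- by apply: subringD => //; apply: subringM.
- by apply: subringB => //; apply: subringM.
- have -> : p2 * (y1 + a1 * w2) = p1 * y2 - (p1 * y2 - p2 * y1) + p2 * a1 * w2 by ring.
  by rewrite Ey12 Ew; ring.
exists x', y'; split=> //; apply: (mulfI p1n).
have -> : p1 * (a1 * x' + a2 * y') = a1 * (p1 * x') + a2 * (p1 * y') by ring.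
by rewrite -Ex' -Ey' E1; ring.
Qed.

End RegularSequences.

(** * Regularity of monic polynomials *)

Section MonicRegular.

(** The coefficient of [p z] in degree [deg p + i] is [z_i] plus multiples of coefficients of [z]
    above [i], so descending induction on [i] applies. Thus a monic polynomial is no zero divisor
    modulo the extension of an ideal of constants. *)
Lemma monic_coef_ideal (T : comNzRingType) (I : T -> Prop) (p z : {poly T}) :
  I 0 -> (forall x y, I x -> I y -> I (x - y)) -> (forall x y, I y -> I (x * y)) ->
  p \is monic -> (forall i, I (p * z)`_i) -> forall i, I z`_i.
Proof.
move=> I0 IB IM pm Ipz.
have ID x y : I x -> I y -> I (x + y).
  by move=> Ix Iy; rewrite -[y]opprK -[- y]sub0r; exact: IB Ix (IB _ _ I0 Iy).
suff H k i : (size z <= i + k)%N -> I z`_i by move=> i; apply: (H (size z)); rewrite leq_addl.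
elim: k i => [|k IH] i Hi; first by rewrite nth_default // -[i]addn0.
have {}IH j : (i < j)%N -> I z`_j.
  by move=> ij; apply: IH; apply: leq_trans Hi _; rewrite addnS -addSn leq_add2r.
set d := (size p).-1.
have sp : size p = d.+1 by rewrite prednK // size_poly_gt0 monic_neq0.
have := Ipz (d + i)%N; rewrite coefM.
have di : (d < (d + i).+1)%N by rewrite ltnS leq_addr.
rewrite (bigD1 (Ordinal di)) //= addKn.
have -> : p`_d = 1 by rewrite /d -lead_coefE (monicP pm).
rewrite mul1r => Is.
set s := (X in z`_i + X) in Is.
have -> : z`_i = (z`_i + s) - s by rewrite addrK.
apply: (IB) => //; rewrite /s; apply: (big_ind I) => // j.
rewrite -val_eqE /= => jd.
have [dj|dj] := ltnP d j.
  by rewrite nth_default ?mul0r // sp.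
apply: IM; apply: IH; have : (j < d)%N by rewrite ltn_neqAle jd.
by move=> {}dj; lia.
Qed.

Lemma polyC_ideal2 (T : comNzRingType) (a b : T) (z : {poly T}) :
  (forall i, exists x y, z`_i = a * x + b * y) ->
  exists x y, z = a%:P * x + b%:P * y.
Proof.
elim/poly_ind: z => [_|z c IH Hz]; first by exists 0, 0; rewrite !mulr0 addr0.
have [|x [y Ez]] := IH.
  by move=> i; have [x [y E]] := Hz i.+1; exists x, y; rewrite -E coefD coefMX coefC addr0.
have [x0 [y0 E0]] := Hz 0; rewrite coefD coefMX coefC add0r /= in E0.
exists (x * 'X + x0%:P), (y * 'X + y0%:P).
by rewrite E0 Ez rmorphD !rmorphM /=; ring.
Qed.

Variable T : idomainType.

(** In [T[X][Y]] divisibility by [q1] is tested coefficientwise, first in [Y] and then in [X], the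
    variable in which [q2] is monic. *)
Lemma regular_pair_monic (q1 : T) (q2 : {poly T}) : q2 \is monic ->
  regular_pair (fun _ => True) q2%:P (q1%:P)%:P.
Proof.
move=> mq2 x y _ _ E.
(* A second generator 0 brings the principal ideal into the form of [polyC_ideal2]. *)
suff [z [z' ->]] : exists z z', x = (q1%:P)%:P * z + 0%:P * z'.
  by exists z; rewrite // polyC0 mul0r addr0.
apply: polyC_ideal2 => i.
have Ei : q2 * x`_i = q1%:P * y`_i by rewrite -!coefCM E.
suff [z [z' ->]] : exists z z', x`_i = q1%:P * z + 0%:P * z'.
  by exists z, z'; rewrite polyC0.
apply: polyC_ideal2 => j.
pose I := fun t : T => exists u v, t = q1 * u + 0 * v.
apply: (@monic_coef_ideal T I q2) => //.
- by exists 0, 0; ring.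
- by move=> u v [u1 [u2 ->]] [v1 [v2 ->]]; exists (u1 - v1), 0; ring.
- by move=> u v [v1 [v2 ->]]; exists (u * v1), 0; ring.
by move=> k; rewrite Ei coefCM; exists (y`_i`_k), 0; ring.
Qed.

Lemma regular_mod_pair_monic (q1 : T) (q2 : {poly T}) (q3 : {poly {poly T}}) : q3 \is monic ->
  regular_mod_pair (fun _ => True) (q1%:P)%:P q2%:P q3.
Proof.
move=> mq3 x y z _ _ _ E.
suff [x' [y' ->]] : exists x' y', z = (q1%:P)%:P * x' + q2%:P * y' by exists x', y'.
apply: polyC_ideal2 => i.
pose I := fun t : {poly T} => exists u v, t = q1%:P * u + q2 * v.
apply: (@monic_coef_ideal _ I q3) => //.
- by exists 0, 0; ring.
- by move=> u v [u1 [u2 ->]] [v1 [v2 ->]]; exists (u1 - v1), (u2 - v2); ring.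
- by move=> u v [v1 [v2 ->]]; exists (u * v1), (u * v2); ring.
by move=> k; rewrite E coefD !coefCM; exists (x`_k), (y`_k).
Qed.

End MonicRegular.

(** * Regular sequences on free modules *)

Section FreeModules.

Variables (S : idomainType) (T : idomainType).
Implicit Types (R : S -> Prop) (chi : {rmorphism T -> S}).

(** Scalars act through an arbitrary ring morphism, so that freeness can follow a change of
    coordinates of the polynomial ring. Independence concerns the coefficients in [T] themselves,
    not their images. *)
Definition free_over R chi : Prop :=
  exists B : S -> Prop,
    [/\ forall b, B b -> R b,
        forall r, R r -> exists (s : seq S) (c : S -> T),
          (forall b, b \in s -> B b) /\ r = \sum_(b <- s) chi (c b) * b
      & forall (s : seq S) (c : S -> T), uniq s -> (forall b, b \in s -> B b) ->
          \sum_(b <- s) chi (c b) * b = 0 -> forall b, b \in s -> c b = 0].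

(** Lists of basis elements may repeat entries; this moves the multiplicities into the
    coefficients. *)
Lemma sum_count_uniq (s0 s : seq S) (F : S -> S) : uniq s -> {subset s0 <= s} ->
  \sum_(b <- s0) F b = \sum_(b <- s) F b *+ count_mem b s0.
Proof.
move=> us; elim: s0 => [_|x s0 IH sub].
  by rewrite big_nil big1.
rewrite big_cons IH; last by move=> y ys; apply: sub; rewrite inE ys orbT.
have xs : x \in s by apply: sub; rewrite inE eqxx.
rewrite [RHS](bigD1_seq x) //= eqxx mulrnDr mulr1n -addrA; congr (_ + _).
rewrite [LHS](bigD1_seq x) //=; congr (_ + _).
by apply: eq_bigr => y /negPf; rewrite eq_sym => ->.
Qed.

(** Puts finitely many elements over one duplicate-free list of basis elements, where equations are
    compared coordinatewise. *)
Lemma free_over_coords (R : S -> Prop) chi (B : S -> Prop) :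
  (forall r, R r -> exists (s : seq S) (c : S -> T),
          (forall b, b \in s -> B b) /\ r = \sum_(b <- s) chi (c b) * b) ->
  forall rs : seq S, (forall r, r \in rs -> R r) ->
  exists s : seq S, [/\ uniq s, forall b, b \in s -> B b
    & forall r, r \in rs -> exists c : S -> T, r = \sum_(b <- s) chi (c b) * b].
Proof.
move=> gen; elim=> [_|r rs IH Rrs]; first by exists [::].
have [|s [us sB Hs]] := IH; first by move=> x xrs; apply: Rrs; rewrite inE xrs orbT.
have [|s0 [c0 [s0B Er]]] := gen r; first by apply: Rrs; rewrite inE eqxx.
exists (undup (s0 ++ s)); split; first exact: undup_uniq.
  by move=> b; rewrite mem_undup mem_cat => /orP[/s0B|/sB].
have ext (s1 : seq S) c1 : {subset s1 <= s0 ++ s} ->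
    exists c, \sum_(b <- s1) chi (c1 b) * b = \sum_(b <- undup (s0 ++ s)) chi (c b) * b.
  move=> sub; exists (fun b => c1 b *+ count_mem b s1).
  rewrite (@sum_count_uniq s1 (undup (s0 ++ s))) ?undup_uniq //.
    by apply: eq_bigr => b _; rewrite rmorphMn mulrnAl.
  by move=> x xs; rewrite mem_undup sub.
move=> x; rewrite inE => /predU1P[->|/Hs[c ->]].
  by rewrite Er; apply: ext => b bs; rewrite mem_cat bs.
by apply: ext => b bs; rewrite mem_cat bs orbT.
Qed.

Lemma sum_coordsM chi (s : seq S) (c : S -> T) (p : T) :
  chi p * \sum_(b <- s) chi (c b) * b = \sum_(b <- s) chi (p * c b) * b.
Proof. by rewrite mulr_sumr; apply: eq_bigr => b _; rewrite rmorphM mulrA. Qed.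

Lemma sum_coordsD chi (s : seq S) (c c' : S -> T) :
  \sum_(b <- s) chi (c b) * b + \sum_(b <- s) chi (c' b) * b
    = \sum_(b <- s) chi (c b + c' b) * b.
Proof. by rewrite -big_split; apply: eq_bigr => b _ /=; rewrite rmorphD mulrDl. Qed.

Lemma sum_coords_inj chi (B : S -> Prop) :
  (forall (s : seq S) (c : S -> T), uniq s -> (forall b, b \in s -> B b) ->
     \sum_(b <- s) chi (c b) * b = 0 -> forall b, b \in s -> c b = 0) ->
  forall (s : seq S) (c c' : S -> T), uniq s -> (forall b, b \in s -> B b) ->
    \sum_(b <- s) chi (c b) * b = \sum_(b <- s) chi (c' b) * b ->
    forall b, b \in s -> c b = c' b.
Proof.
move=> ind s c c' us sB E b bs; apply/subr0_eq.
apply: (ind s (fun b => c b - c' b)) => //.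
rewrite (eq_bigr (fun b => chi (c b) * b - chi (c' b) * b)).
  by rewrite sumrB E subrr.
by move=> b' _; rewrite rmorphB mulrBl.
Qed.

(** Finite choice by induction on the list, hence without an axiom; [y0] is the value off the
    list. *)
Lemma seq_choice (X : eqType) (Y : Type) (y0 : Y) (s : seq X) (P : X -> Y -> Prop) :
  (forall x, x \in s -> exists y, P x y) ->
  exists f : X -> Y, forall x, x \in s -> P x (f x).
Proof.
elim: s => [|x s IH] H; first by exists (fun _ => y0).
have [|f Hf] := IH; first by move=> z zs; apply: H; rewrite inE zs orbT.
have [|y Hy] := H x; first by rewrite inE eqxx.
exists (fun z => if z == x then y else f z) => z.
by rewrite inE; case: eqP => [-> //|_] /=; apply: Hf.
Qed.

(** The relation holds in each coordinate, where regularity in [T] applies. *)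
Lemma regular_pair_free R chi (a b : T) : subring R -> (forall t, R (chi t)) ->
  free_over R chi ->
  regular_pair (fun _ => True) a b -> regular_pair R (chi a) (chi b).
Proof.
move=> sR Rchi [B [BR gen ind]] reg x y Rx Ry E.
have [|s [us sB Hs]] := @free_over_coords R chi B gen [:: x; y].
  by move=> r; rewrite !inE => /orP[/eqP->|/eqP->].
have [|c Ex] := Hs x; first by rewrite inE eqxx.
have [|c' Ey] := Hs y; first by rewrite !inE eqxx orbT.
move: E; rewrite Ex Ey !sum_coordsM => /(sum_coords_inj ind us sB) E.
have [d Hd] : exists d : S -> T, forall b', b' \in s -> c b' = b * d b'.
  apply: (@seq_choice S T 0 s (fun b' e => c b' = b * e)) => b' b's.
  by have [|||z _ ->] := reg (c b') (c' b'); rewrite ?E //; exists z.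
exists (\sum_(b' <- s) chi (d b') * b').
  rewrite big_seq; apply: subring_sum => // b' b's.
  by apply: subringM => //; apply/BR/sB.
rewrite sum_coordsM big_seq [RHS]big_seq; apply: eq_bigr => b' b's.
by rewrite Hd.
Qed.

Lemma regular_mod_pair_free R chi (a b p : T) : subring R -> (forall t, R (chi t)) ->
  free_over R chi -> regular_mod_pair (fun _ => True) a b p ->
  regular_mod_pair R (chi a) (chi b) (chi p).
Proof.
move=> sR Rchi [B [BR gen ind]] reg x y z Rx Ry Rz E.
have [|s [us sB Hs]] := @free_over_coords R chi B gen [:: x; y; z].
  by move=> r; rewrite !inE => /or3P[/eqP->|/eqP->|/eqP->].
have [|c Ex] := Hs x; first by rewrite inE eqxx.
have [|c' Ey] := Hs y; first by rewrite !inE eqxx orbT.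
have [|c'' Ez] := Hs z; first by rewrite !inE eqxx !orbT.
move: E; rewrite Ex Ey Ez !sum_coordsM sum_coordsD => /(sum_coords_inj ind us sB) E.
have [d Hd] : exists d : S -> T * T, forall b', b' \in s ->
    c'' b' = a * (d b').1 + b * (d b').2.
  apply: (@seq_choice S (T * T)%type (0, 0) s
    (fun b' e => c'' b' = a * e.1 + b * e.2)) => b' b's.
  have [|x' [y' [_ _ ->]]] := reg (c b') (c' b') (c'' b') I I I; first by rewrite E.
  by exists (x', y').
have Rd (e : S -> T) : R (\sum_(b' <- s) chi (e b') * b').
  rewrite big_seq; apply: subring_sum => // b' b's.
  by apply: subringM => //; apply/BR/sB.
exists (\sum_(b' <- s) chi (d b').1 * b'), (\sum_(b' <- s) chi (d b').2 * b').
split; [exact: Rd | exact: Rd |].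
rewrite !sum_coordsM sum_coordsD big_seq [RHS]big_seq; apply: eq_bigr => b' b's.
by rewrite Hd.
Qed.

End FreeModules.

Lemma free_over_iso (S T T' : idomainType) (R : S -> Prop)
    (chi : {rmorphism T -> S}) (w : {rmorphism T -> T'}) (w' : {rmorphism T' -> T}) :
  cancel w w' -> cancel w' w -> free_over R chi -> free_over R (chi \o w').
Proof.
move=> ww' w'w [B [BR gen ind]]; exists B; split=> //.
  move=> r Rr; have [s [c [sB ->]]] := gen r Rr; exists s, (w \o c); split=> //.
  by apply: eq_bigr => b _ /=; rewrite ww'.
move=> s c us sB E b bs; apply: (can_inj w'w); rewrite rmorph0.
exact: (ind s (w' \o c)).
Qed.

(** * Noether normalization and algebraic dependence *)

Lemma mpoly_rmorph_ext (K : idomainType) n (S : comNzRingType)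
    (u v : {rmorphism {mpoly K[n]} -> S}) :
  (forall c, u c%:MP = v c%:MP) -> (forall i, u 'X_i = v 'X_i) -> u =1 v.
Proof.
move=> uvC uvX p; rewrite [p]mpolyE !rmorph_sum; apply: eq_bigr => m _.
rewrite -mul_mpolyC !rmorphM /= uvC; congr (_ * _).
rewrite mpolyXE_id !rmorph_prod; apply: eq_bigr => i _.
by rewrite !rmorphXn /= uvX.
Qed.

Lemma poly_rmorph_ext (T S : comNzRingType) (u v : {rmorphism {poly T} -> S}) :
  (forall c, u c%:P = v c%:P) -> u 'X = v 'X -> u =1 v.
Proof.
move=> uvC uvX p; elim/poly_ind: p => [|p c IH]; first by rewrite !rmorph0.
by rewrite !rmorphD !rmorphM /= IH uvX uvC.
Qed.

(** Uniqueness of base-[N] expansions; it separates the weights of the monomials in the Noether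
    normalization. *)
Lemma digits_inj N k (m m' : 'I_k -> nat) :
  (forall i, m i < N)%N -> (forall i, m' i < N)%N ->
  (\sum_(i < k) m i * N ^ i = \sum_(i < k) m' i * N ^ i)%N -> m =1 m'.
Proof.
elim: k m m' => [|k IH] m m' mN m'N; first by move=> _ [].
rewrite !big_ord_recl /= expn0 !muln1.
have shift (l : 'I_k.+1 -> nat) : (\sum_(i < k) l (lift ord0 i) * N ^ bump 0 i
    = (\sum_(i < k) l (lift ord0 i) * N ^ i) * N)%N.
  rewrite big_distrl /=; apply: eq_bigr => i _.
  by rewrite /bump add1n expnS mulnA mulnAC -!mulnA [(N ^ _ * N)%N]mulnC.
rewrite !shift => E.
have E0 : m ord0 = m' ord0.
  have := congr1 (modn^~ N) E.
  by rewrite /= ![(_ + _ * N)%N]addnC !modnMDl !modn_small.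
have N0 : (0 < N)%N by apply: leq_ltn_trans (mN ord0).
move: E; rewrite E0 => /addnI /eqP; rewrite eqn_pmul2r // => /eqP E i.
case: (unliftP ord0 i) => [j ->|-> //].
exact: (IH (fun j => m (lift ord0 j)) (fun j => m' (lift ord0 j))).
Qed.

Lemma seq_argmax (X : eqType) (s : seq X) (D : X -> nat) : s != [::] ->
  exists2 x, x \in s & forall y, y \in s -> (D y <= D x)%N.
Proof.
elim: s => // x [|y s] IH _.
  by exists x; rewrite ?inE // => z; rewrite inE => /eqP->.
have [//|z zs Hz] := IH; have [xz|zx] := leqP (D x) (D z).
  by exists z; rewrite ?inE 1?orbC -?in_cons ?zs // => t; rewrite inE => /predU1P[->|/Hz].
exists x; rewrite ?inE ?eqxx // => t; rewrite inE => /predU1P[->|/Hz] //.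
by move/leq_trans; apply; apply: ltnW.
Qed.

Section NoetherNormalization.

Variables (K : fieldType) (n N : nat).

(** Nagata's substitution: exponents below [N] become the base-[N] digits of the degree in the
    distinguished variable, the image of ['X_ord0]. *)
Definition nn_var (i : 'I_n.+1) : {poly {mpoly K[n]}} :=
  if unlift ord0 i is Some j then 'X^(N ^ i) + ('X_j)%:P else 'X.

Definition nn := mmap (polyC \o @mpolyC n K) nn_var.

Definition nn_inv_var : n.-tuple {mpoly K[n.+1]} :=
  [tuple 'X_(lift ord0 j) - 'X_ord0 ^+ (N ^ (lift ord0 j)) | j < n].

Definition nn_inv := horner_eval ('X_ord0 : {mpoly K[n.+1]}) \o
  map_poly (comp_mpoly nn_inv_var).

HB.instance Definition _ := GRing.RMorphism.on nn.
HB.instance Definition _ := GRing.RMorphism.on nn_inv.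

Lemma nnC c : nn c%:MP = (c%:MP)%:P. Proof. by rewrite /nn mmapC. Qed.

Lemma nnX i : nn 'X_i = nn_var i. Proof. by rewrite /nn mmapX mmap1U. Qed.

Lemma nn_invC p : nn_inv p%:P = p \mPo nn_inv_var.
Proof. by rewrite /nn_inv /= map_polyC horner_evalE hornerC. Qed.

Lemma nn_invX : nn_inv 'X = 'X_ord0.
Proof. by rewrite /nn_inv /= map_polyX horner_evalE hornerX. Qed.

Lemma nnK : cancel nn nn_inv.
Proof.
move=> p; apply: (@mpoly_rmorph_ext K n.+1 _ (nn_inv \o nn) idfun) => [c|i] /=.
  by rewrite nnC nn_invC comp_mpolyC.
rewrite nnX /nn_var; case: unliftP => [j ->|->]; last exact: nn_invX.
rewrite rmorphD rmorphXn /= nn_invX nn_invC comp_mpolyXU -tnth_nth tnth_mktuple.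
by rewrite addrCA subrr addr0.
Qed.

Lemma nn_invK : cancel nn_inv nn.
Proof.
move=> p; apply: (@poly_rmorph_ext _ _ (nn \o nn_inv) idfun) => [q|] /=; last first.
  by rewrite nn_invX nnX /nn_var unlift_none.
apply: (@mpoly_rmorph_ext K n _ ((nn \o nn_inv) \o polyC) polyC) => [c|i] /=.
  by rewrite nn_invC comp_mpolyC nnC.
rewrite nn_invC comp_mpolyXU -tnth_nth tnth_mktuple rmorphB rmorphXn /= !nnX.
by rewrite /nn_var liftK unlift_none addrAC subrr add0r.
Qed.

Let weight (m : 'X_{1..n.+1}) := (\sum_(i < n.+1) m i * N ^ i)%N.

Lemma nn_monomial (m : 'X_{1..n.+1}) : (0 < N)%N ->
  nn 'X_[m] \is monic /\ size (nn 'X_[m]) = (weight m).+1.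
Proof.
move=> N0; rewrite mpolyXE_id rmorph_prod /weight.
pose P (p : {poly {mpoly K[n]}}) k := p \is monic /\ size p = k.+1.
have PM p q k l : P p k -> P q l -> P (p * q) (k + l)%N.
  by move=> [mp sp] [mq sq]; split; [exact: rpredM | rewrite size_monicM ?monic_neq0 // sp sq addnS].
apply: (big_ind2 P); [by split; rewrite ?monic1 ?size_poly1 | by move=> *; exact: PM |].
move=> i _; rewrite rmorphXn /= nnX.
have Pi : P (nn_var i) (N ^ i)%N.
  rewrite /nn_var; case: unliftP => [j _|->]; last by split; rewrite ?monicX ?size_polyX.
  have Ni : (0 < N ^ i)%N by rewrite expn_gt0 N0.
  by split; rewrite ?size_XnaddC // monicE lead_coefXnaddC.
elim: (m i) => [|k IH]; first by split; rewrite ?monic1 ?size_poly1.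
by rewrite exprS mulSn; apply: PM.
Qed.

(** Distinct monomials of [p] have distinct weights, so only the one of largest weight contributes
    to the leading coefficient, which is therefore a nonzero constant. *)
Lemma nn_monic (p : {mpoly K[n.+1]}) : p != 0 -> (msize p <= N)%N ->
  exists2 c : K, c != 0 & nn (c *: p) \is monic.
Proof.
move=> p0 pN.
have N0 : (0 < N)%N.
  by apply: leq_trans pN; rewrite lt0n msize_poly_eq0.
have [|m mp Hm] := @seq_argmax _ (msupp p) weight; first by rewrite msupp_eq0.
have mlt m' i : m' \in msupp p -> (m' i < N)%N.
  move=> /msize_mdeg_lt /leq_trans /(_ pN); apply: leq_ltn_trans.
  by rewrite mdegE (bigD1 i) //= leq_addr.
have wlt m' : m' \in msupp p -> m' != m -> (weight m' < weight m)%N.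
  move=> m'p; apply: contra_neqT; rewrite -leqNgt => le.
  have E : weight m' = weight m by apply/eqP; rewrite eqn_leq Hm.
  by apply/mnmP; apply: digits_inj E => i; apply: mlt.
have coefN k : (weight m <= k)%N -> (nn p)`_k = ((p@_m)%:MP *+ (k == weight m)).
  move=> mk; rewrite {1}[p]mpolyE rmorph_sum coef_sum (bigD1_seq m) ?msupp_uniq //=.
  rewrite big1_seq => [|m' /andP[m'm m'p]].
    rewrite addr0 -mul_mpolyC rmorphM /= nnC coefCM.
    have [mo sz] := nn_monomial m N0; case: eqVneq => [->|km].
      by move/monicP: mo; rewrite lead_coefE sz /= => ->; rewrite mulr1.
    by rewrite nth_default ?mulr0 // sz ltn_neqAle eq_sym km.
  rewrite -mul_mpolyC rmorphM /= nnC coefCM nth_default ?mulr0 //.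
  by have [_ ->] := nn_monomial m' N0; apply: leq_trans mk; apply: wlt.
have pm0 : p@_m != 0 by rewrite -mcoeff_msupp.
exists (p@_m)^-1; first by rewrite invr_eq0.
have lp : lead_coef (nn p) = (p@_m)%:MP.
  have szp : size (nn p) = (weight m).+1.
    apply/eqP; rewrite eqn_leq; apply/andP; split.
      by apply/leq_sizeP => k mk; rewrite coefN ?(ltnW mk) // gtn_eqF.
    rewrite ltnNge; apply/negP => /leq_sizeP/(_ _ (leqnn _)).
    by rewrite coefN // eqxx => /eqP; rewrite mpolyC_eq0 (negPf pm0).
  by rewrite lead_coefE szp /= coefN // eqxx.
rewrite -mul_mpolyC rmorphM /= nnC monicE lead_coefM lead_coefC lp -rmorphM /=.
by rewrite mulVf // mpolyC1.
Qed.

End NoetherNormalization.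

Lemma noether_normalization (K : fieldType) n (p : {mpoly K[n.+1]}) : p != 0 ->
  exists (w : {rmorphism {mpoly K[n.+1]} -> {poly {mpoly K[n]}}})
         (w' : {rmorphism {poly {mpoly K[n]}} -> {mpoly K[n.+1]}}),
    [/\ cancel w w', cancel w' w, forall c, w c%:MP = (c%:MP)%:P
      & exists2 c : K, c != 0 & w (c *: p) \is monic].
Proof.
move=> p0; exists (@nn K n (msize p)), (@nn_inv K n (msize p)).
by split; [exact: nnK | exact: nn_invK | exact: nnC | exact: nn_monic].
Qed.

(** * Algebraic dependence by counting monomials *)

Section AlgebraicDependence.

Lemma linear_dependence (K : fieldType) (X Y : finType) (A : X -> Y -> K) :
  (#|Y| < #|X|)%N ->
  exists2 u : X -> K, (exists x, u x != 0) & forall y, \sum_x u x * A x y = 0.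
Proof.
move=> YX.
pose M := \matrix_(i < #|X|, j < #|Y|) A (enum_val i) (enum_val j).
have /rowV0Pn[v /sub_kermxP vM v0] : kermx M != 0.
  rewrite -mxrank_eq0 mxrank_ker -lt0n subn_gt0.
  exact: leq_ltn_trans (rank_leq_col _) YX.
exists (fun x => v 0 (enum_rank x)).
  have [i vi] : exists i, v 0 i != 0.
    apply/existsP; apply: contraNT v0 => /existsPn H.
    by apply/eqP/rowP => i; rewrite mxE; apply/eqP/negPn/H.
  by exists (enum_val i); rewrite enum_valK.
move=> y; have /rowP/(_ (enum_rank y)) := vM; rewrite !mxE; apply: etrans.
rewrite (reindex (@enum_val X predT)) /=; last exact: (onW_bij _ (enum_val_bij _)).
by apply: eq_bigr => i _; rewrite mxE enum_valK enum_rankK.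
Qed.

Lemma card_bmnm d B : (#|{: 'X_{1..d < B}}| <= B.+1 ^ d)%N.
Proof.
have -> : (B.+1 ^ d)%N = #|{ffun 'I_d -> 'I_B.+1}| by rewrite card_ffun !card_ord.
apply: (leq_card (fun m : 'X_{1..d < B} => [ffun i => inord (m i) : 'I_B.+1])).
move=> m m' /ffunP E; apply/val_inj/mnmP => i.
have lt (m0 : 'X_{1..d < B}) : (m0 i < B.+1)%N.
  by rewrite ltnS; apply: leq_trans (ltnW (bmdeg m0)); rewrite mdegE (bigD1 i) //= leq_addr.
by have /(congr1 val) := E i; rewrite !ffunE /= !inordK.
Qed.

Lemma msizeM_leD (K : idomainType) d (p q : {mpoly K[d]}) :
  (msize (p * q) <= msize p + msize q)%N.
Proof.
have [->|p0] := eqVneq p 0; first by rewrite mul0r msize0.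
have [->|q0] := eqVneq q 0; first by rewrite mulr0 msize0.
by rewrite msizeM ?leq_pred.
Qed.

Variables (K : closedFieldType) (n : nat).
Local Notation S := {mpoly K[n]}.

Definition subalgebra (R : S -> Prop) : Prop := subring R /\ forall c, R c%:MP.

Lemma subalgebraZ (R : S -> Prop) c x : subalgebra R -> R x -> R (c *: x).
Proof. by case=> sR RC Rx; rewrite -mul_mpolyC; apply: subringM. Qed.

Lemma subalgebra_prodX (R : S -> Prop) (I : finType) (w : I -> S) (k : I -> nat) :
  subalgebra R -> (forall i, R (w i)) -> R (\prod_i w i ^+ k i).
Proof.
case=> sR _ Rw; apply: (big_ind R) => [|x y|i _]; first by case: sR.
  exact: subringM.
exact: subringX.
Qed.

Lemma subalgebra_comp (R : S -> Prop) k (f : k.-tuple S) P : subalgebra R ->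
  (forall i, R (tnth f i)) -> R (P \mPo f).
Proof.
move=> aR Rf; rewrite comp_mpolyE; apply: subring_sum => [|m _]; first by case: aR.
by apply: subalgebraZ => //; apply: subalgebra_prodX.
Qed.

Variables (R : S -> Prop) (d : nat) (f : d.-tuple S).

(** A filtration of the module by the size of the coefficients; multiplication by a fixed element of
    [R] raises the level by a constant only. *)
Let W (h : seq S) B (r : S) := exists2 c : S -> {mpoly K[d]},
  forall b, b \in h -> (msize (c b) <= B)%N & r = \sum_(b <- h) (c b \mPo f) * b.

Let W_mono h B B' r : (B <= B')%N -> W h B r -> W h B' r.
Proof. by move=> BB' [c cB ->]; exists c => // b /cB /leq_trans; apply. Qed.

Let W_exists h r : (exists c : S -> {mpoly K[d]}, r = \sum_(b <- h) (c b \mPo f) * b) ->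
  exists B, W h B r.
Proof.
case=> c ->; exists (\max_(b <- h) msize (c b))%N; exists c => // b bh.
exact: (@leq_bigmax_seq _ h predT (fun b => msize (c b))).
Qed.

Let W_mul h C B w r : (forall b, b \in h -> W h C (w * b)) -> W h B r ->
  W h (C + B) (w * r).
Proof.
move=> wh [c cB ->].
have [c' c'P] := @seq_choice S (S -> {mpoly K[d]}) (fun _ => 0) h (fun b e =>
  (forall b', b' \in h -> (msize (e b') <= C)%N) /\
  w * b = \sum_(b' <- h) (e b' \mPo f) * b') (fun b bh =>
  let: ex_intro2 e p q := wh b bh in ex_intro _ e (conj p q)).
exists (fun b' => \sum_(b <- h) c b * c' b b') => [b' b'h|].
  rewrite /=; apply: leq_trans (msize_sum _ _ _) _; apply/bigmax_leqP_seq => b bh _.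
  apply: leq_trans (msizeM_leD _ _) _.
  by rewrite addnC leq_add ?cB //; have [->] := c'P b bh.
rewrite mulr_sumr big_seq.
rewrite (eq_bigr (fun b => \sum_(b' <- h) ((c b * c' b b') \mPo f) * b')).
  rewrite -big_seq exchange_big /=; apply: eq_bigr => b' _.
  by rewrite raddf_sum mulr_suml.
move=> b bh; rewrite mulrCA; have [_ ->] := c'P b bh.
by rewrite mulr_sumr; apply: eq_bigr => b' _; rewrite rmorphM mulrA.
Qed.

(* The [N ^ #|I|] monomials with exponents less than [N] lie in the span of
   [O(N ^ d)] products of a generator and a monomial in [f]. *)
Lemma finite_module_dependence (I : finType) (w : I -> S) :
  subalgebra R -> (forall i, R (w i)) -> finite_module_over R f -> (d < #|I|)%N ->
  exists N (u : {ffun I -> 'I_N} -> K),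
    (exists x, u x != 0) /\ \sum_x u x *: \prod_i w i ^+ x i = 0.
Proof.
move=> aR Rw [h Rh gen] dI; have sR := aR.1.
have [C HC] : exists C, forall i b, b \in h -> W h C (w i * b).
  have HCi i : exists C, forall b, b \in h -> W h C (w i * b).
    have [g Hg] := @seq_choice S nat 0%N h (fun b B => W h B (w i * b))
      (fun b bh => W_exists (gen _ (subringM sR (Rw i) (Rh b bh)))).
    exists (\max_(b <- h) g b)%N => b bh; apply: W_mono (Hg b bh).
    exact: (@leq_bigmax_seq _ h predT g).
  have [g Hg] := @seq_choice I nat 0%N (enum I)
    (fun i B => forall b, b \in h -> W h B (w i * b)) (fun i _ => HCi i).
  exists (\max_(i <- enum I) g i)%N => i b bh; apply: W_mono (Hg i _ b bh).
    by apply: (@leq_bigmax_seq _ (enum I) predT g); rewrite ?mem_enum.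
  by rewrite mem_enum.
have [C0 H1] : exists C0, W h C0 1 by apply/W_exists/gen; case: sR.
have WX i k B r : W h B r -> W h (C * k + B) (w i ^+ k * r).
  move=> Wr; elim: k => [|k IH]; first by rewrite muln0 add0n expr0 mul1r.
  by rewrite mulnS exprS -addnA -mulrA; apply: W_mul => //; apply: HC.
have WP N (x : {ffun I -> 'I_N}) : W h (C * N * #|I| + C0) (\prod_i w i ^+ x i).
  rewrite -(mulr1 (\prod_i _)) cardE -sum1_size big_distrr /=.
  under eq_bigr do rewrite muln1.
  rewrite -[X in X * 1]big_enum /=.
  elim: (enum I) => [|i s IH]; first by rewrite !big_nil mul1r.
  rewrite !big_cons -addnA -mulrA; apply: W_mono (WX i (x i) _ _ IH).
  by rewrite leq_add2r leq_mul2l ltnW ?orbT.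
(* All monomials lie in level [B], and [B + 1 <= D N], so there are at most [s (D N)^d] equations.
   The value of [N] makes this less than [N^(d+1)], which is at most the number [N^k] of
   unknowns. *)
pose k := #|I|; pose s := size h; pose D := (C * k + C0 + 1)%N.
pose N := (s * D ^ d).+1; pose B := (C * N * k + C0)%N.
have [c Hc] := @seq_choice {ffun I -> 'I_N} (S -> {mpoly K[d]}) (fun _ => 0)
  (enum {ffun I -> 'I_N}) (fun x e =>
  (forall b, b \in h -> (msize (e b) <= B)%N) /\
  \prod_i w i ^+ x i = \sum_(b <- h) (e b \mPo f) * b) (fun x _ =>
  let: ex_intro2 e p q := WP N x in ex_intro _ e (conj p q)).
have {}Hc x := Hc x (mem_enum _ x).
have cards : (#|{: 'I_s * 'X_{1..d < B}}| < #|{ffun I -> 'I_N}|)%N.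
  rewrite card_prod card_ffun !card_ord -/k.
  apply: (@leq_ltn_trans (s * (D * N) ^ d)%N).
    rewrite leq_mul2l; apply/orP; right; apply: leq_trans (card_bmnm _ _) _.
    have [->|d0] := posnP d; first by rewrite !expn0.
    rewrite leq_exp2r // /B /D -addn1 !mulnDl mul1n.
    by rewrite -!mulnA [(N * k)%N]mulnC leq_add // leq_add // leq_pmulr.
  apply: (@leq_trans (N ^ d.+1)%N); last exact: leq_pexp2l.
  by rewrite expnMn mulnA expnS ltn_pmul2r ?expn_gt0.
have [u u0 Hu] := @linear_dependence K _ _
  (fun (x : {ffun I -> 'I_N}) (jm : 'I_s * 'X_{1..d < B}) => (c x h`_jm.1)@_(jm.2)) cards.
exists N, u; split=> //.
have E (x : {ffun I -> 'I_N}) : \prod_i w i ^+ x i = \sum_(j < s) \sum_(m : 'X_{1..d < B})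
    (c x h`_j)@_m *: (('X_[m] \mPo f) * h`_j).
  have [szc ->] := Hc x; rewrite (big_nth 0) big_mkord; apply: eq_bigr => j _.
  rewrite {1}[c x _](mpolywE (szc _ (mem_nth _ (ltn_ord j)))) raddf_sum mulr_suml.
  by apply: eq_bigr => m _; rewrite /= comp_mpolyZ -scalerAl.
rewrite (eq_bigr (fun x => \sum_(jm : 'I_s * 'X_{1..d < B})
   (u x * (c x h`_jm.1)@_(jm.2)) *: (('X_[jm.2] \mPo f) * h`_jm.1))).
  rewrite exchange_big big1 //= => jm _.
  by rewrite -scaler_suml Hu scale0r.
move=> x _; rewrite E pair_big /= scaler_sumr; apply: eq_bigr => jm _.
by rewrite scalerA.
Qed.

End AlgebraicDependence.

(** * Cohen-Macaulay subalgebras containing three variables *)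

Section VariableIdeals.

Variables (K : closedFieldType) (n : nat).
Local Notation S := {mpoly K[n]}.

(** Membership in the ideal of the whole polynomial ring generated by the ['X_(v i)], not in the
    ideal they generate in a subalgebra. *)
Definition in_vars_ideal k (v : 'I_k -> 'I_n) (h : S) : Prop :=
  forall m : 'X_{1..n}, (forall i, m (v i) = 0%N) -> h@_m = 0.

Lemma mcoeff_mulX_ge (h : S) (m m' : 'X_{1..n}) :
  ('X_[m] * h)@_m' = if (m <= m')%MM then h@_(m' - m) else 0.
Proof.
rewrite mulrC; case: ifP => [le|nle].
  by rewrite -{1}(submK le) addmC mcoeffMX.
apply: memN_msupp_eq0; rewrite (perm_mem (msuppMX _ _)).
by apply/mapP => -[m1 _ E]; rewrite E lem_addr in nle.
Qed.

(** The [k + e] elements satisfy an algebraic relation. Among its terms, those with a fixed exponent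
    vector in the variables ['X_(v i)], of minimal total degree, form a monomial times [P \mPo r];
    modulo the variables nothing else survives after division by that monomial. *)
Lemma dependence_mod_vars (R : S -> Prop) d (f : d.-tuple S) k (v : 'I_k -> 'I_n)
    e (r : e.-tuple S) :
  subalgebra R -> injective v -> (forall i, R 'X_(v i)) ->
  (forall i, R (tnth r i)) -> finite_module_over R f -> (d < k + e)%N ->
  exists2 P : {mpoly K[e]}, P != 0 & in_vars_ideal v (P \mPo r).
Proof.
move=> aR vI Rv Rr fin dke.
pose w (i : 'I_k + 'I_e) : S := match i with inl i => 'X_(v i) | inr j => tnth r j end.
have Rw i : R (w i) by case: i.
have dI : (d < #|{: 'I_k + 'I_e}|)%N by rewrite card_sum !card_ord.
have [N [u [[x0 ux0] E]]] := finite_module_dependence aR Rw fin dI.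
pose ldeg (x : {ffun 'I_k + 'I_e -> 'I_N}) := (\sum_i x (inl i))%N.
case: (@arg_minnP _ x0 (fun x => u x != 0) ldeg ux0) => {ux0} x ux xmin.
pose al (y : {ffun 'I_k + 'I_e -> 'I_N}) := [ffun i => y (inl i)].
pose ml (y : {ffun 'I_k + 'I_e -> 'I_N}) : 'X_{1..n} := (\sum_i U_(v i) *+ y (inl i))%MM.
pose mr (y : {ffun 'I_k + 'I_e -> 'I_N}) : 'X_{1..e} := [multinom (y (inr j) : nat) | j < e].
have mlv y i : ml y (v i) = y (inl i).
  rewrite /ml mnm_sumE (bigD1 i) //= mulmnE mnm1E eqxx mul1n big1 ?addn0 // => j ji.
  by rewrite mulmnE mnm1E (inj_eq vI) (negPf ji).
have prodE (y : {ffun 'I_k + 'I_e -> 'I_N}) : \prod_i w i ^+ y i = 'X_[ml y] * ('X_[mr y] \mPo r).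
  rewrite big_sumType /= -mprodXE comp_mpolyX; congr (_ * _).
    by apply: eq_bigr => i _; rewrite mpolyXn.
  by apply: eq_bigr => j _; rewrite mnmE.
pose P : {mpoly K[e]} := \sum_(y | al y == al x) u y *: 'X_[mr y].
exists P.
  apply: contraNneq ux => P0; have /(congr1 (mcoeff (mr x))) := P0.
  rewrite mcoeff0 raddf_sum (bigD1 x) //= mcoeffZ mcoeffX eqxx mulr1 big1 ?addr0 => [->//|].
  move=> y /andP[/eqP yx nyx]; rewrite mcoeffZ mcoeffX; case: eqP => [Em|_]; last by rewrite mulr0.
  case/eqP: nyx; apply/ffunP => -[i|j].
    by have /ffunP/(_ i) := yx; rewrite !ffunE.
  by apply: val_inj; have /mnmP/(_ j) := Em; rewrite !mnmE.
move=> m mv; have /(congr1 (mcoeff (ml x + m)%MM)) := E.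
rewrite mcoeff0 raddf_sum (bigID (fun y => al y == al x)) /= [X in _ + X]big1 ?addr0.
  move=> E2; rewrite -[RHS]E2 /P (raddf_sum (comp_mpoly r)) (raddf_sum (mcoeff m)) /=; apply: eq_bigr => y /eqP yx.
  have -> : ml x = ml y.
    by apply: eq_bigr => i _; have /ffunP/(_ i) := yx; rewrite !ffunE => ->.
  by rewrite /= comp_mpolyZ !mcoeffZ prodE mcoeff_mulX_ge lem_addr
    [(ml y + m)%MM]addmC addmK.
(* A further term could contribute only if its exponents in the variables were at most those of [x];
   minimality of [ldeg x] would then force equality. *)
move=> y yx; rewrite mcoeffZ prodE mcoeff_mulX_ge; case: ifP => [/mnm_lepP le|_]; last by rewrite mulr0.
have lei i : (y (inl i) <= x (inl i))%N.
  by have := le (v i); rewrite mnmDE !mlv mv addn0.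
have [->|uy] := eqVneq (u y) 0; first by rewrite mul0r.
case/eqP: yx; apply/ffunP => i; rewrite !ffunE; apply/val_inj/eqP.
rewrite eqn_leq lei /= leqNgt; apply/negP => lt.
have := xmin y uy; rewrite leqNgt => /negP; apply.
rewrite /ldeg (bigD1 i) //= [X in (_ < X)%N](bigD1 i) //= -addSn.
by apply: leq_add => //; apply: leq_sum.
Qed.

Lemma mpolyX_neq0 (m : 'X_{1..n}) : 'X_[m] != 0 :> S.
Proof. by rewrite -msupp_eq0 msuppX. Qed.

(** Every monomial of [x] contains ['X_j], so the quotient exists in the polynomial ring; closure of
    [R] under division by its variables puts it into [R]. *)
Lemma regular_pair_vars (R : S -> Prop) i j : i != j ->
  (forall k x, R 'X_k -> R ('X_k * x) -> R x) -> R 'X_j -> regular_pair R 'X_i 'X_j.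
Proof.
move=> ij Rdiv Rj x y Rx Ry E.
pose z := \sum_(m <- msupp x) x@_m *: 'X_[m - U_(j)] : S.
suff Ez : x = 'X_j * z by exists z => //; apply: (Rdiv j); rewrite -?Ez.
rewrite /z mulr_sumr {1}[x]mpolyE big_seq [RHS]big_seq; apply: eq_bigr => m mx.
rewrite -scalerAr -mpolyXD addmC submK //.
rewrite lep1mP; apply: contraTneq mx => mj.
have := congr1 (mcoeff (U_(i) + m)%MM) E.
rewrite !mcoeff_mulX_ge lem_addr addmC addmK ifF => [/eqP|]; first by rewrite mcoeff_eq0.
by apply/negbTE; rewrite lep1mP mnmDE mj mnm1E (negPf ij).
Qed.

End VariableIdeals.

(** * Unmixedness in Cohen-Macaulay subalgebras *)

Section Unmixedness.

Variables (K : closedFieldType) (n : nat).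
Local Notation S := {mpoly K[n]}.
Variables (R : S -> Prop) (v : 'I_3 -> 'I_n).
Hypotheses (aR : subalgebra R) (vI : injective v) (Rv : forall i, R 'X_(v i)).
Hypothesis Rdiv : forall k x, R 'X_k -> R ('X_k * x) -> R x.
Hypothesis Rrad : forall h, R h -> in_vars_ideal v h ->
  exists N (c : 'I_3 -> S), (forall i, R (c i)) /\ h ^+ N = \sum_i 'X_(v i) * c i.

(** By [Rrad] a power of the relation lies in the ideal generated inside [R], and that power is
    still a nonzero polynomial. *)
Lemma relation_in_ideal d (f : d.-tuple S) e (r : e.-tuple S) :
  finite_module_over R f -> (forall i, R (tnth r i)) -> (d < 3 + e)%N ->
  exists2 P : {mpoly K[e]}, P != 0 &
    exists2 c : 'I_3 -> S, forall i, R (c i) & P \mPo r = \sum_i 'X_(v i) * c i.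
Proof.
move=> fin Rr de; have [P P0 HP] := dependence_mod_vars aR vI Rv Rr fin de.
have [N [c [Rc Ec]]] := Rrad (subalgebra_comp P aR Rr) HP.
by exists (P ^+ N); [rewrite expf_neq0 | exists c; rewrite // rmorphXn].
Qed.

Lemma free_over_comp k (f : k.-tuple S) : alg_independent f -> free_module_over R f ->
  free_over R (comp_mpoly f).
Proof.
move=> indf [B [BR gen ind]]; exists B; split=> // s c us sB E b bs.
exact/indf/(ind s c us sB E).
Qed.

(* Three Noether normalizations produce elements of [K[f_1, ..., f_d]] in the
   ideal, each monic in a variable of its own, hence a regular sequence. *)
Lemma exists_regular_triple : cohen_macaulay R ->
  exists p1 p2 p3 : S,
    [/\ p1 != 0, regular_pair R p2 p1, regular_mod_pair R p1 p2 p3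
      & forall p, p \in [:: p1; p2; p3] -> R p /\
          exists2 c : 'I_3 -> S, forall i, R (c i) & p = \sum_i 'X_(v i) * c i].
Proof.
have sR := aR.1.
case=> d [f [[Rf _ indf fin] /(free_over_comp indf) free]].
have rel e (r : e.-tuple S) := @relation_in_ideal d f e r fin.
have [d2|d2] := ltnP d 2.
  have [||P P0 [c Rc Ec]] := rel 0 [tuple]; [by case|by apply: leq_trans d2 _|].
  have P1 : P \mPo [tuple] = (P@_0%MM)%:MP :> S.
    by rewrite [in LHS](nvar0_mpolyC P) comp_mpolyC.
  have p0 : P@_0%MM != 0 by apply: contraNneq P0 => E; rewrite [P]nvar0_mpolyC E.
  have : (P \mPo [tuple] : S)@_0%MM = 0.
    rewrite Ec raddf_sum big1 // => i _.
    by rewrite /= mcoeff_mulX_ge ifF //; apply/negbTE; rewrite lep1mP mnm0E.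
  by rewrite P1 mcoeffC eqxx mulr1 => E; rewrite E eqxx in p0.
case: d d2 f Rf indf fin free rel => [|[|e]] // _ f Rf indf fin free rel.
(* [P3] uses all [d] parameters, [P2] the [d - 1] coordinates left when [P3] is monic in one, and
   [P1] the [d - 2] left after [P2]; the bound of [rel] still holds for [d - 2]. *)
have [||P3 P30 [c3 Rc3 E3]] := rel _ f; [exact: Rf | by lia |].
have [w3 [w3' [w3K w3'K w3C [k3 k30 mon3]]]] := noether_normalization P30.
have [chi1 [Echi1 free1]] : exists chi1 : {rmorphism {poly {mpoly K[e.+1]}} -> S},
    (forall t, chi1 t = w3' t \mPo f) /\ free_over R chi1.
  by exists (comp_mpoly f \o w3'); split=> //; apply: free_over_iso w3K w3'K free.
have chi1_inj t : chi1 t = 0 -> t = 0.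
  by rewrite Echi1 => /indf/(congr1 w3); rewrite w3'K rmorph0.
have Rchi1 t : R (chi1 t) by rewrite Echi1; apply: subalgebra_comp.
pose f1 := [tuple chi1 ('X_i)%:P | i < e.+1].
have Ef1 P : P \mPo f1 = chi1 P%:P.
  apply: (@mpoly_rmorph_ext K e.+1 _ (comp_mpoly f1) (chi1 \o polyC)) => [a|i] /=.
    by rewrite comp_mpolyC -w3C Echi1 w3K comp_mpolyC.
  by rewrite comp_mpolyXU -tnth_nth tnth_mktuple.
have [||P2 P20 [c2 Rc2 E2]] := rel _ f1.
- by move=> i; rewrite tnth_mktuple.
- by lia.
have [w2 [w2' [w2K w2'K w2C [k2 k20 mon2]]]] := noether_normalization P20.
have W2K : cancel (map_poly w2) (map_poly w2').
  by move=> q; rewrite -map_poly_comp map_poly_id // => x _ /=; apply: w2K.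
have W2'K : cancel (map_poly w2') (map_poly w2).
  by move=> q; rewrite -map_poly_comp map_poly_id // => x _ /=; apply: w2'K.
have [chi2 [Echi2 free2]] : exists chi2 : {rmorphism {poly {poly {mpoly K[e]}}} -> S},
    (forall t, chi2 t = chi1 (map_poly w2' t)) /\ free_over R chi2.
  by exists (chi1 \o map_poly w2'); split=> //; apply: free_over_iso W2K W2'K free1.
have chi2_inj t : chi2 t = 0 -> t = 0.
  by rewrite Echi2 => /chi1_inj/(congr1 (map_poly w2)); rewrite W2'K rmorph0.
have Rchi2 t : R (chi2 t) by rewrite Echi2.
pose f2 := [tuple chi2 (('X_i)%:P)%:P | i < e].
have Ef2 P : P \mPo f2 = chi2 (P%:P)%:P.
  apply: (@mpoly_rmorph_ext K e _ (comp_mpoly f2) (chi2 \o (polyC \o polyC))) => [a|i] /=.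
    by rewrite comp_mpolyC -w2C Echi2 map_polyC /= w2K -w3C Echi1 w3K comp_mpolyC.
  by rewrite comp_mpolyXU -tnth_nth tnth_mktuple.
have [||P1 P10 [c1 Rc1 E1]] := rel _ f2.
- by move=> i; rewrite tnth_mktuple.
- by lia.
(* [P1] is constant in both distinguished variables, [P2] is monic in the inner one and [P3] in the
   outer one; applying [w2] to its coefficients keeps [P3] monic. *)
exists (chi2 (P1%:P)%:P), (chi2 (w2 (k2 *: P2))%:P), (chi2 (map_poly w2 (w3 (k3 *: P3)))).
split.
- by apply: contraNneq P10 => /chi2_inj/eqP; rewrite !polyC_eq0.
- by apply: regular_pair_free => //; apply: regular_pair_monic.
- apply: regular_mod_pair_free => //; apply: regular_mod_pair_monic.
  exact: monic_map.
have scale (k : K) (P : S) (c : 'I_3 -> S) : (forall i, R (c i)) ->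
    P = \sum_i 'X_(v i) * c i ->
    exists2 c : 'I_3 -> S, forall i, R (c i) & k *: P = \sum_i 'X_(v i) * c i.
  move=> Rc ->; exists (fun i => k *: c i) => [i|]; first exact: subalgebraZ.
  by rewrite scaler_sumr; apply: eq_bigr => i _; rewrite scalerAr.
move=> p; rewrite !inE => /or3P[]/eqP->; split=> //.
- by exists c1; rewrite // -Ef2.
- by rewrite Echi2 map_polyC /= w2K -Ef1 comp_mpolyZ; apply: scale E2.
- by rewrite Echi2 W2K Echi1 w3K comp_mpolyZ; apply: scale E3.
Qed.

(** Each [p] of the regular triple is a combination of the three variables, two of which generate
    the ideal while the third multiplies [u] into it; hence [p u] lies in the ideal too. *)
Lemma cm_unmixed u : cohen_macaulay R -> R u ->
  (exists x y, [/\ R x, R y & 'X_(v (inord 2)) * u = 'X_(v (inord 0)) * x + 'X_(v (inord 1)) * y]) ->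
  exists x y, [/\ R x, R y & u = 'X_(v (inord 0)) * x + 'X_(v (inord 1)) * y].
Proof.
have sR := aR.1.
move=> /exists_regular_triple[p1 [p2 [p3 [p10 reg2 reg3 pR]]]] Ru [x2 [y2 [Rx2 Ry2 E2]]].
apply: (@regular_pair_unmixed _ R _ _ p1 p2 p3 u) => //; rewrite ?mpolyX_neq0 //.
- by have [|] := pR p1; rewrite ?inE ?eqxx.
- by have [|] := pR p2; rewrite ?inE ?eqxx ?orbT.
- by have [|] := pR p3; rewrite ?inE ?eqxx ?orbT.
- by apply: regular_pair_vars => //; rewrite (inj_eq vI) -val_eqE /= !inordK.
move=> p /pR[_ [c Rc ->]].
have -> : \sum_i 'X_(v i) * c i = 'X_(v (inord 0)) * c (inord 0)
    + 'X_(v (inord 1)) * c (inord 1) + 'X_(v (inord 2)) * c (inord 2).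
  rewrite !big_ord_recl big_ord0 addr0 addrA.
  by do 3 ?[congr (_ + _)]; congr ('X_(v _) * c _); apply: val_inj; rewrite /= inordK.
exists (c (inord 0) * u + c (inord 2) * x2), (c (inord 1) * u + c (inord 2) * y2).
split; try by apply: subringD => //; apply: subringM.
rewrite 2!mulrDl.
have -> : 'X_(v (inord 2)) * c (inord 2) * u = c (inord 2) * ('X_(v (inord 2)) * u) by ring.
by rewrite E2; ring.
Qed.

End Unmixedness.

(** * Geometric reductivity of SL_2 *)

Section BinaryForms.

Lemma closed_field_infinite (K : closedFieldType) (s : seq K) : exists x, x \notin s.
Proof.
have /closed_nonrootP[x Hx] : \prod_(a <- s) ('X - a%:P) != 0.
  by rewrite prodf_seq_neq0; apply/allP => a _; rewrite polyXsubC_eq0.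
by exists x; apply: contra Hx; rewrite root_prod_XsubC.
Qed.

Lemma poly_eq0_cofinite (K : closedFieldType) (S : idomainType) (u : {rmorphism K -> S})
    (s : seq K) (p : {poly S}) : (forall x, x \notin s -> p.[u x] = 0) -> p = 0.
Proof.
move=> H; apply/eqP; apply/negPn/negP => p0.
have [t [ut nst tN]] : exists t : seq K, [/\ uniq t, all (fun x => x \notin s) t & size t = size p].
  elim: (size p) => [|N [t [ut nst tN]]]; first by exists [::].
  have [x] := closed_field_infinite (t ++ s); rewrite mem_cat => /norP[xt xs].
  by exists (x :: t); rewrite /= xt ut xs nst tN.
have := @max_poly_roots _ p (map u t) p0.
rewrite size_map tN ltnn map_inj_uniq //; last exact: fmorph_inj.
rewrite ut; suff -> : all (root p) (map u t) by move=> /(_ isT isT).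
by rewrite all_map; apply: sub_all nst => x xs /=; apply/eqP/H.
Qed.

Definition bin_mono (R : pzSemiRingType) r (x y : R) : 'cV[R]_(r.+1) :=
  \col_(i < r.+1) (x ^+ i * y ^+ (r - i)).

Lemma bin_monoZ (R : comPzSemiRingType) r (c x y : R) :
  bin_mono r (c * x) (c * y) = c ^+ r *: bin_mono r x y.
Proof.
apply/colP => i; rewrite !mxE !exprMn mulrACA -exprD subnKC //.
by rewrite -ltnS.
Qed.

Section CofiniteUniqueness.

Variables (K : closedFieldType) (S : idomainType) (u : {rmorphism K -> S}).

(** Linear independence of monomials; the finite exceptional set allows points with [x = y] to be
    avoided in [biform_uniq]. *)
Lemma bin_mono_cofinite r (s : seq K) (c : 'rV[S]_(r.+1)) :
  (forall x, x \notin s -> c *m bin_mono r (u x) 1 = 0) -> c = 0.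
Proof.
move=> H; suff P0 : \poly_(i < r.+1) c 0 (inord i) = 0.
  apply/rowP => i; rewrite mxE; have := congr1 (fun p : {poly S} => p`_i) P0.
  by rewrite coef_poly ltn_ord inord_val coef0.
apply: (@poly_eq0_cofinite K S u s) => x /H /matrixP/(_ 0 0); rewrite !mxE => Hx.
rewrite -[RHS]Hx horner_poly; apply: eq_bigr => i _.
by rewrite !mxE inord_val expr1n mulr1.
Qed.

End CofiniteUniqueness.

(* [f |-> f(a x + b y, c x + d y)] on binary forms of degree [r]; row [i] holds the
   coefficients of the image of [x ^ i y ^ (r - i)]. *)
Definition bin_act (K : comNzRingType) r (s : 'M[K]_2) : 'M[K]_(r.+1) :=
  \matrix_(i, k) (((s 0 0) *: 'X + (s 0 1)%:P) ^+ i *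
                  ((s 1 0) *: 'X + (s 1 1)%:P) ^+ (r - i))`_k.

(** Recovers a form of degree [r] from its dehomogenization at [y = 1], the shape in which [bin_act]
    stores forms. *)
Definition homogenize (K : comNzRingType) r (p : {poly K}) (x y : K) :=
  \sum_(k < r.+1) p`_k * (x ^+ k * y ^+ (r - k)).

Lemma size_lin (K : comNzRingType) (a b : K) : (size (a *: 'X + b%:P)%R <= 2)%N.
Proof.
apply: leq_trans (size_polyD _ _) _; rewrite geq_max size_polyC.
by case: (b != 0); rewrite andbT ?(leq_trans (size_scale_leq _ _)) ?size_polyX.
Qed.

Lemma homogenize_lin (K : comNzRingType) r (p : {poly K}) (a b x y : K) :
  (size p <= r.+1)%N ->
  homogenize r.+1 ((a *: 'X + b%:P) * p) x y = (a * x + b * y) * homogenize r p x y.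
Proof.
move=> sp; rewrite /homogenize mulrDl [RHS]mulrDl -[X in _ = X + _]mulrA -[X in _ = _ + X]mulrA.
under eq_bigr do rewrite coefD -scalerAl coefZ coefXM coefCM mulrDl.
rewrite big_split /=; congr (_ + _).
  rewrite big_ord_recl /= mulr0 mul0r add0r !mulr_sumr; apply: eq_bigr => i _.
  by rewrite /= add0n subSS exprS; ring.
rewrite big_ord_recr /= nth_default // mulr0 mul0r addr0 !mulr_sumr.
apply: eq_bigr => i _; rewrite subSn ?exprS; first by ring.
by rewrite -ltnS.
Qed.

Lemma homogenize_bin (K : comNzRingType) i j (a b c d x y : K) :
  let p := (a *: 'X + b%:P) ^+ i * (c *: 'X + d%:P) ^+ j in
  (size p <= (i + j).+1)%N /\
  homogenize (i + j) p x y = (a * x + b * y) ^+ i * (c * x + d * y) ^+ j.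
Proof.
have step a' b' r (p : {poly K}) z : (size p <= r.+1)%N /\ homogenize r p x y = z ->
    (size (((a' *: 'X + b'%:P) * p)%R : {poly K}) <= r.+2)%N /\
    homogenize r.+1 ((a' *: 'X + b'%:P) * p) x y = (a' * x + b' * y) * z.
  move=> [sp <-]; split; last exact: homogenize_lin.
  apply: leq_trans (size_polyMleq _ _) _; rewrite -subn1 leq_subLR add1n.
  by apply: leq_trans (leq_add (size_lin a' b') sp) _; rewrite add2n.
move=> p; rewrite {}/p; elim: i => [|i IH].
  rewrite add0n !expr0 !mul1r; elim: j => [|j IH]; last by rewrite !exprS; apply: step.
  rewrite !expr0 size_poly1 /homogenize big_ord_recr big_ord0 /= add0r coef1.
  by rewrite !mul1r.
by rewrite !exprS -!mulrA addSn; apply: step.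
Qed.

Lemma bin_actE (K : comNzRingType) r (s : 'M[K]_2) (x y : K) :
  bin_mono r (s 0 0 * x + s 0 1 * y) (s 1 0 * x + s 1 1 * y)
    = bin_act r s *m bin_mono r x y.
Proof.
apply/colP => i; rewrite !mxE.
have ir : (i + (r - i) = r)%N by rewrite subnKC // -ltnS.
have [_] := homogenize_bin i (r - i) (s 0 0) (s 0 1) (s 1 0) (s 1 1) x y.
rewrite ir => <-; apply: eq_bigr => k _.
by rewrite !mxE.
Qed.

Variable K : closedFieldType.

Lemma bin_act_uniq r (A B : 'M[K]_(r.+1)) :
  (forall x y, A *m bin_mono r x y = B *m bin_mono r x y) -> A = B.
Proof.
move=> H; apply/subr0_eq/row_matrixP => i; rewrite row0.
apply: (@bin_mono_cofinite K K idfun r [::]) => x _.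
by rewrite -row_mul mulmxBl H subrr row0.
Qed.

Lemma bin_act1 r : bin_act r 1%:M = 1%:M :> 'M[K]_(r.+1).
Proof.
apply: bin_act_uniq => x y; rewrite -bin_actE mul1mx !mxE /=.
by rewrite !mul1r !mul0r addr0 add0r.
Qed.

Lemma mulmx22 (s t : 'M[K]_2) i j : (s *m t) i j = s i 0 * t 0 j + s i 1 * t 1 j.
Proof.
rewrite mxE !big_ord_recl big_ord0 addr0.
by have -> : lift ord0 ord0 = 1 :> 'I_2 by apply: val_inj.
Qed.

Lemma bin_actM r (s t : 'M[K]_2) : bin_act r (s *m t) = bin_act r s *m bin_act r t.
Proof.
apply: bin_act_uniq => x y; rewrite -mulmxA -!bin_actE !mulmx22.
by congr (bin_mono r _ _); ring.
Qed.

Lemma bin_act_diag r (s : 'M[K]_2) : s 0 1 = 0 -> s 1 0 = 0 -> is_diag_mx (bin_act r s).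
Proof.
move=> s01 s10; apply/is_diag_mxP => i j ij; rewrite mxE s01 s10 scale0r add0r.
rewrite -[r]/(_) addr0 exprZn -rmorphXn /= coefMC coefZ coefXn.
by rewrite eq_sym (negPf ij) mulr0 mul0r.
Qed.

End BinaryForms.

Lemma invmxM (K : fieldType) m (s t : 'M[K]_m) : s \in unitmx -> t \in unitmx ->
  invmx (s *m t) = invmx t *m invmx s.
Proof.
move=> us ut; have ust : s *m t \in unitmx by rewrite unitmx_mul us.
apply: (can_inj (mulKmx ust)); rewrite mulmxV // mulmxA -[s *m t *m _]mulmxA.
by rewrite mulmxV // mulmx1 mulmxV.
Qed.

(** * The action on K[V] and its invariants *)

Section PolynomialAction.

Variables (K : closedFieldType) (m n : nat) (G : 'M[K]_m -> Prop) (rho : 'M[K]_m -> 'M[K]_n).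
Local Notation S := {mpoly K[n]}.
Local Notation act := (poly_act rho).

Let act_tuple s : n.-tuple S := [tuple \sum_(j < n) rho (invmx s) i j *: 'X_j | i < n].

HB.instance Definition _ s :=
  GRing.Linear.copy (poly_act rho s) (comp_mpoly (act_tuple s)).
HB.instance Definition _ s :=
  GRing.RMorphism.copy (poly_act rho s) (comp_mpoly (act_tuple s)).

Lemma poly_actX s i : act s 'X_i = \sum_j rho (invmx s) i j *: 'X_j.
Proof. by rewrite /poly_act comp_mpolyXU -tnth_nth tnth_mktuple. Qed.

Lemma poly_actC s c : act s c%:MP = c%:MP.
Proof. exact: comp_mpolyC. Qed.

Lemma poly_actZ s c f : act s (c *: f) = c *: act s f.
Proof. exact: comp_mpolyZ. Qed.

Hypotheses (closedG : closed_subgroup_GL G) (modG : Gmodule G rho).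

Lemma closed_subgroup_unit s : G s -> s \in unitmx.
Proof. by case: closedG => -[T HT] _ _ _ /HT[]. Qed.

Lemma poly_actM s t f : G s -> G t -> act (s *m t) f = act s (act t f).
Proof.
move=> Gs Gt; have [us ut] := (closed_subgroup_unit Gs, closed_subgroup_unit Gt).
apply: (@mpoly_rmorph_ext K n _ (act (s *m t)) (act s \o act t)) => [c|i] /=.
  by rewrite !poly_actC.
have [_ _ _ Ginv] := closedG; have [_ rhoM _] := modG.
rewrite !poly_actX invmxM // rhoM; try exact: Ginv.
rewrite (raddf_sum (act s)).
under [RHS]eq_bigr do rewrite /= poly_actZ poly_actX scaler_sumr.
rewrite exchange_big /=; apply: eq_bigr => j _; rewrite mxE scaler_suml.
by apply: eq_bigr => k _; rewrite scalerA.
Qed.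

Lemma invariant_subalgebra : subalgebra (invariant_ring G rho).
Proof.
split; last by move=> c s _; apply: poly_actC.
split=> [s _|x y Rx Ry s Gs|x y Rx Ry s Gs]; first by rewrite rmorph1.
  by rewrite rmorphB /= Rx ?Ry.
by rewrite rmorphM /= Rx ?Ry.
Qed.

Lemma invariant_div a x : a != 0 -> invariant_ring G rho a ->
  invariant_ring G rho (a * x) -> invariant_ring G rho x.
Proof.
move=> a0 Ra Rax s Gs; apply: (mulfI a0).
by rewrite -{1}(Ra s Gs) -rmorphM /= Rax.
Qed.

End PolynomialAction.

(** * Polynomial functions on SL_2 *)

Section SL2Polynomials.

Variables (K : closedFieldType) (S : comAlgType K).
Implicit Types (F : 'M[K]_2 -> S) (e : (nat * nat) * (nat * nat)).

(** Exponents are grouped by the columns of [s], which right multiplication by a diagonal matrix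
    scales separately. *)
Definition entry_mono e (s : 'M[K]_2) : K :=
  (s 0 0 ^+ e.1.1 * s 1 0 ^+ e.1.2) * (s 0 1 ^+ e.2.1 * s 1 1 ^+ e.2.2).

Definition sl2_poly F : Prop := exists l : seq (S * ((nat * nat) * (nat * nat))),
  forall s, \det s = 1 -> F s = \sum_(t <- l) entry_mono t.2 s *: t.1.

Lemma sl2_poly_eq F F' : (forall s, \det s = 1 -> F s = F' s) -> sl2_poly F' -> sl2_poly F.
Proof. by move=> FF' [l Hl]; exists l => s ds; rewrite FF' ?Hl. Qed.

Lemma sl2_polyC c : sl2_poly (fun _ => c).
Proof.
exists [:: (c, ((0, 0), (0, 0))%N)] => s _.
by rewrite big_seq1 /entry_mono /= !expr0 !mulr1 scale1r.
Qed.

Lemma sl2_polyD F F' : sl2_poly F -> sl2_poly F' -> sl2_poly (fun s => F s + F' s).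
Proof. by move=> [l Hl] [l' Hl']; exists (l ++ l') => s ds; rewrite big_cat Hl ?Hl'. Qed.

Lemma sl2_polyM F F' : sl2_poly F -> sl2_poly F' -> sl2_poly (fun s => F s * F' s).
Proof.
move=> [l Hl] [l' Hl'].
exists [seq (t.1 * t'.1, ((t.2.1.1 + t'.2.1.1, t.2.1.2 + t'.2.1.2),
  (t.2.2.1 + t'.2.2.1, t.2.2.2 + t'.2.2.2))%N) | t <- l, t' <- l'] => s ds.
rewrite Hl ?Hl' // big_allpairs_dep mulr_suml; apply: eq_bigr => t _.
rewrite mulr_sumr; apply: eq_bigr => t' _; rewrite -scalerAl -scalerAr scalerA.
by congr (_ *: _); rewrite /entry_mono /= !exprD; ring.
Qed.

Lemma sl2_poly_sum (I : Type) (r : seq I) (P : pred I) (F : I -> 'M[K]_2 -> S) :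
  (forall i, sl2_poly (F i)) -> sl2_poly (fun s => \sum_(i <- r | P i) F i s).
Proof.
move=> HF; elim: r => [|i r IH].
  by apply: sl2_poly_eq (sl2_polyC 0) => s _; rewrite big_nil.
case Pi: (P i); last by apply: sl2_poly_eq IH => s _; rewrite big_cons Pi.
by apply: sl2_poly_eq (sl2_polyD (HF i) IH) => s _; rewrite big_cons Pi.
Qed.

Lemma sl2_poly_prod (I : Type) (r : seq I) (F : I -> 'M[K]_2 -> S) :
  (forall i, sl2_poly (F i)) -> sl2_poly (fun s => \prod_(i <- r) F i s).
Proof.
move=> HF; elim: r => [|i r IH].
  by apply: sl2_poly_eq (sl2_polyC 1) => s _; rewrite big_nil.
by apply: sl2_poly_eq (sl2_polyM (HF i) IH) => s _; rewrite big_cons.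
Qed.

Lemma sl2_polyX F k : sl2_poly F -> sl2_poly (fun s => F s ^+ k).
Proof.
move=> HF; elim: k => [|k IH]; first exact: sl2_polyC.
by apply: sl2_poly_eq (sl2_polyM HF IH) => s _; rewrite exprS.
Qed.

Lemma ord2P (i : 'I_2) : i = 0 \/ i = 1.
Proof. by case: i => [[|[|//]] ?]; [left|right]; apply: val_inj. Qed.

Lemma det22 (s : 'M[K]_2) : \det s = s 0 0 * s 1 1 - s 0 1 * s 1 0.
Proof.
rewrite (expand_det_row _ 0) !big_ord_recl big_ord0 addr0 /cofactor !det_mx11 !mxE /=.
have -> : lift ord0 ord0 = 1 :> 'I_2 by apply: val_inj.
have -> : lift 1 0 = 0 :> 'I_2 by apply: val_inj.
by rewrite addn0 /bump leqnn expr0 expr1 mul1r mulN1r mulrN.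
Qed.

Definition mx22 (a b c d : K) : 'M[K]_2 :=
  \matrix_(i, j) if i == 0 then (if j == 0 then a else b) else (if j == 0 then c else d).

Lemma mx22_eq (s t : 'M[K]_2) : s 0 0 = t 0 0 -> s 0 1 = t 0 1 ->
  s 1 0 = t 1 0 -> s 1 1 = t 1 1 -> s = t.
Proof. by move=> *; apply/matrixP => i j; case: (ord2P i) (ord2P j) => -> [] ->. Qed.

Lemma invmx22 (s : 'M[K]_2) : s \in unitmx ->
  invmx s = (\det s)^-1 *: mx22 (s 1 1) (- s 0 1) (- s 1 0) (s 0 0).
Proof.
move=> us; have d0 : \det s != 0 by rewrite -unitfE -unitmxE.
apply: (can_inj (mulKmx us)); rewrite mulmxV // -scalemxAr.
apply: (@scalerI _ _ (\det s)) => //; rewrite scalerA mulfV // scale1r det22.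
by apply: mx22_eq; rewrite ?mulmx22 !mxE /=; ring.
Qed.

Lemma is_diag_invmx (s : 'M[K]_2) : s \in unitmx -> is_diag_mx s -> is_diag_mx (invmx s).
Proof.
move=> us /is_diag_mxP ds; rewrite invmx22 //; apply/is_diag_mxP => i j; rewrite !mxE.
by case: (ord2P i) (ord2P j) => -> [] -> //= _; rewrite ds // oppr0 mulr0.
Qed.

Lemma sl2_poly_entry i j : sl2_poly (fun s => (s i j) *: 1).
Proof.
have H e : sl2_poly (fun s => entry_mono e s *: 1).
  by exists [:: (1, e)] => s _; rewrite big_seq1.
case: (ord2P i) (ord2P j) => -> [] ->.
- by apply: sl2_poly_eq (H ((1, 0), (0, 0))%N) => s _; rewrite /entry_mono /= expr1 !expr0 !mulr1.
- by apply: sl2_poly_eq (H ((0, 0), (1, 0))%N) => s _; rewrite /entry_mono /= expr1 !expr0 !mulr1 mul1r.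
- by apply: sl2_poly_eq (H ((0, 1), (0, 0))%N) => s _; rewrite /entry_mono /= expr1 !expr0 !mulr1 mul1r.
- by apply: sl2_poly_eq (H ((0, 0), (0, 1))%N) => s _; rewrite /entry_mono /= expr1 !expr0 !mul1r.
Qed.

Lemma sl2_poly_inv_entry i j : sl2_poly (fun s => (invmx s i j) *: 1).
Proof.
have E (s : 'M[K]_2) : \det s = 1 -> invmx s = mx22 (s 1 1) (- s 0 1) (- s 1 0) (s 0 0).
  by move=> ds; rewrite invmx22 ?unitmxE ds ?unitr1 // invr1 scale1r.
have H k l : sl2_poly (fun s => - s k l *: 1).
  apply: sl2_poly_eq (sl2_polyM (sl2_polyC (-1)) (sl2_poly_entry k l)) => s _.
  by rewrite mulN1r scaleNr.
case: (ord2P i) (ord2P j) => -> [] ->.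
- by apply: sl2_poly_eq (sl2_poly_entry 1 1) => s /E->; rewrite mxE.
- by apply: sl2_poly_eq (H 0 1) => s /E->; rewrite mxE.
- by apply: sl2_poly_eq (H 1 0) => s /E->; rewrite mxE.
- by apply: sl2_poly_eq (sl2_poly_entry 0 0) => s /E->; rewrite mxE.
Qed.

End SL2Polynomials.

Lemma det_unit1 (K : fieldType) k (s : 'M[K]_k) : \det s = 1 -> s \in unitmx.
Proof. by move=> ds; rewrite unitmxE ds unitr1. Qed.

Lemma det_invmx1 (K : fieldType) k (s : 'M[K]_k) : \det s = 1 -> \det (invmx s) = 1.
Proof. by move=> ds; rewrite det_inv ds invr1. Qed.

(** On SL_2 the determinants in denominators are 1 and the entries of the inverse are entries up to
    sign, so regular functions become polynomials. *)
Lemma sl2_poly_act (K : closedFieldType) n (G : 'M[K]_2 -> Prop) (rho : 'M[K]_2 -> 'M[K]_n)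
    (f : {mpoly K[n]}) :
  (forall s, \det s = 1 -> G s) -> Gmodule G rho -> sl2_poly (fun s => poly_act rho s f).
Proof.
move=> SL2G [_ _ regrho].
have Hrho i j : sl2_poly (fun s => (rho (invmx s) i j) *: (1 : {mpoly K[n]})).
  have [q [k Hq]] := regrho i j.
  pose F (s : 'M[K]_2) : {mpoly K[n]} :=
    \sum_(m <- msupp q) (q@_m)%:MP * \prod_l (mxvec (invmx s) 0 l *: 1) ^+ m l.
  apply: (@sl2_poly_eq _ _ _ F) => [s ds|].
    rewrite Hq; last exact/SL2G/det_invmx1.
    rewrite det_invmx1 // expr1n divr1 /meval_mx mevalE scaler_suml; apply: eq_bigr => e _.
    rewrite mul_mpolyC -scalerA; congr (_ *: _).
    rewrite -mul_mpolyC mulr1 rmorph_prod; apply: eq_bigr => l _.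
    by rewrite rmorphXn /= -[in RHS]mul_mpolyC mulr1.
  apply: sl2_poly_sum => e; apply: sl2_polyM; first exact: sl2_polyC.
  apply: sl2_poly_prod => l; apply: sl2_polyX.
  case/mxvec_indexP: l => a b.
  by apply: sl2_poly_eq (sl2_poly_inv_entry _ a b) => s _; rewrite mxvecE.
pose X s i := poly_act rho s 'X_i.
apply: (@sl2_poly_eq _ _ _ (fun s => \sum_(m <- msupp f) (f@_m)%:MP * \prod_i X s i ^+ m i)).
  move=> s _; rewrite {1}[f]mpolyE raddf_sum; apply: eq_bigr => e _.
  rewrite /= poly_actZ mul_mpolyC; congr (_ *: _).
  rewrite mpolyXE_id rmorph_prod; apply: eq_bigr => i _; exact: rmorphXn.
apply: sl2_poly_sum => e; apply: sl2_polyM; first exact: sl2_polyC.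
apply: sl2_poly_prod => i; apply: sl2_polyX.
apply: (@sl2_poly_eq _ _ _ (fun s => \sum_j (rho (invmx s) i j *: 1) * 'X_j)) => [s _|].
  by rewrite /X poly_actX; apply: eq_bigr => j _; rewrite -scalerAl mul1r.
by apply: sl2_poly_sum => j; apply: sl2_polyM => //; apply: sl2_polyC.
Qed.

(** * Bilinear forms in the monomials of the two columns *)

Section BilinearForms.

Variables (K : closedFieldType) (n : nat).
Local Notation S := {mpoly K[n]}.

Definition biform r (E : 'M[S]_(r.+1)) (s : 'M[K]_2) : S :=
  ((bin_mono r (s 0 0)%:MP (s 1 0)%:MP)^T *m E *m bin_mono r (s 0 1)%:MP (s 1 1)%:MP) 0 0.

Lemma biformD r (E E' : 'M[S]_(r.+1)) s : biform (E + E') s = biform E s + biform E' s.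
Proof. by rewrite /biform mulmxDr mulmxDl mxE. Qed.

Lemma biformB r (E E' : 'M[S]_(r.+1)) s : biform (E - E') s = biform E s - biform E' s.
Proof. by rewrite /biform mulmxBr mulmxBl !mxE. Qed.

Lemma biformZ r a (E : 'M[S]_(r.+1)) s : biform (a *: E) s = a * biform E s.
Proof. by rewrite /biform -scalemxAr -scalemxAl mxE. Qed.

Lemma biform_sum r (I : Type) (l : seq I) (E : I -> 'M[S]_(r.+1)) s :
  biform (\sum_(i <- l) E i) s = \sum_(i <- l) biform (E i) s.
Proof.
elim: l => [|i l IH]; last by rewrite !big_cons biformD IH.
by rewrite !big_nil /biform mulmx0 mul0mx mxE.
Qed.

Lemma biform_delta r (i j : 'I_r.+1) s :
  biform (delta_mx i j) s = (entry_mono ((i : nat, r - i), (j : nat, r - j))%N s)%:MP.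
Proof.
rewrite /biform -(mul_delta_mx (0 : 'I_1)) mulmxA -colE -mulmxA -rowE mxE big_ord1 !mxE.
by rewrite /entry_mono /= !rmorphM !rmorphXn.
Qed.

(** For [x != y] the columns [(x, 1)] and [(y, 1)], the second divided by [x - y], form a matrix of
    determinant 1. By homogeneity the form vanishes at all such pairs, and independence of monomials
    applies in each argument. *)
Lemma biform_uniq r (E E' : 'M[S]_(r.+1)) :
  (forall s, \det s = 1 -> biform E s = biform E' s) -> E = E'.
Proof.
move=> H; apply/subr0_eq; set D := E - E'.
have HD s : \det s = 1 -> biform D s = 0 by move=> ds; rewrite biformB H ?subrr.
pose W (x : K) : 'cV[S]_(r.+1) := bin_mono r x%:MP 1.
have HW x y : x \notin [:: y] -> (W x)^T *m D *m W y = 0.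
  rewrite inE -subr_eq0 => xy.
  have ds : \det (mx22 x ((x - y)^-1 * y) 1 ((x - y)^-1 * 1)) = 1.
    by rewrite det22 !mxE /= !mulr1 mulrC -mulrBr mulVf.
  have := HD _ ds; rewrite /biform ![mx22 _ _ _ _ _ _]mxE /= !mpolyC1.
  rewrite !rmorphM bin_monoZ -scalemxAr mxE => /eqP.
  rewrite mulf_eq0 expf_eq0 mpolyC_eq0 invr_eq0 (negPf xy) andbF /= mpolyC1 => /eqP E0.
  by apply/matrixP => i j; rewrite !ord1 E0 mxE.
have DW y : D *m W y = 0.
  apply: trmx_inj; rewrite trmx0; apply: (@bin_mono_cofinite K S (@mpolyC n K) r [:: y]) => x xy.
  by apply: trmx_inj; rewrite trmx0 trmx_mul trmxK mulmxA HW.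
apply/row_matrixP => i; rewrite row0.
apply: (@bin_mono_cofinite K S (@mpolyC n K) r [::]) => y _.
by rewrite -row_mul -/(W y) DW row0.
Qed.

Lemma biform_mul r (E : 'M[S]_(r.+1)) t s :
  biform E (t *m s) = biform ((map_mx (@mpolyC n K) (bin_act r t))^T *m E
                              *m map_mx (@mpolyC n K) (bin_act r t)) s.
Proof.
have W x y x' y' : x' = t 0 0 * x + t 0 1 * y -> y' = t 1 0 * x + t 1 1 * y ->
    bin_mono r x'%:MP y'%:MP
      = map_mx (@mpolyC n K) (bin_act r t) *m bin_mono r x%:MP_[n] y%:MP.
  have mapW a b : bin_mono r a%:MP b%:MP = map_mx (@mpolyC n K) (bin_mono r a b).
    by apply/colP => i; rewrite !mxE rmorphM !rmorphXn.
  by move=> -> ->; rewrite !mapW -map_mxM bin_actE.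
rewrite /biform (W _ _ _ _ (mulmx22 t s 0 0) (mulmx22 t s 1 0)).
by rewrite (W _ _ _ _ (mulmx22 t s 0 1) (mulmx22 t s 1 1)) trmx_mul !mulmxA.
Qed.

(** Right multiplication by the torus element scales a term by [t] to the difference of its column
    degrees, so the terms of weight zero alone represent [F]. *)
Lemma sl2_poly_torus (F : 'M[K]_2 -> S) : sl2_poly F ->
  (forall s t, \det s = 1 -> t != 0 -> F (s *m mx22 t 0 0 t^-1) = F s) ->
  exists l : seq (S * ((nat * nat) * (nat * nat))),
    (forall t, t \in l -> t.2.1.1 + t.2.1.2 = t.2.2.1 + t.2.2.2)%N /\
    forall s, \det s = 1 -> F s = \sum_(t <- l) entry_mono t.2 s *: t.1.
Proof.
case=> l Hl Ftorus.
pose d0 (t : S * ((nat * nat) * (nat * nat))) := (t.2.1.1 + t.2.1.2)%N.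
pose d1 (t : S * ((nat * nat) * (nat * nat))) := (t.2.2.1 + t.2.2.2)%N.
exists [seq t <- l | d0 t == d1 t]; split.
  by move=> t; rewrite mem_filter => /andP[/eqP].
move=> s ds; pose M := (\max_(t <- l) d1 t)%N.
have dM t : t \in l -> (d1 t <= M)%N.
  by move=> tl; apply: (@leq_bigmax_seq _ l predT d1).
(* The shift by [M] avoids negative powers of [t]. Every nonzero scalar is a root, hence [P = 0],
   and its coefficient at ['X^M] is the claim. *)
pose P : {poly S} := \sum_(t <- l) (entry_mono t.2 s *: t.1) *: 'X^(M + d0 t - d1 t)
  - F s *: 'X^M.
have P0 : P = 0.
  apply: (@poly_eq0_cofinite K S (@mpolyC n K) [:: 0]) => x; rewrite inE => x0.
  rewrite /P hornerD hornerN hornerZ hornerXn horner_sum.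
  rewrite -(Ftorus s x ds x0) Hl; last first.
    by rewrite det_mulmx ds mul1r det22 !mxE /= mulr0 subr0 mulfV.
  rewrite mulr_suml -sumrB big1_seq // => t /andP[_ tl].
  rewrite hornerZ hornerXn -!rmorphXn /= !(mulrC _ (_%:MP)) !mul_mpolyC !scalerA -scalerBl.
  suff -> : x ^+ (M + d0 t - d1 t) * entry_mono t.2 s
      = x ^+ M * entry_mono t.2 (s *m mx22 x 0 0 x^-1) by rewrite subrr scale0r.
  rewrite /entry_mono !mulmx22 !mxE /= !mulr0 !addr0 !add0r !exprMn !exprVn.
  rewrite -addnBAC ?dM // -(subnK (dM t tl)) addnK addnC !exprD.
  by field; rewrite !expf_neq0.
have := congr1 (fun q : {poly S} => q`_M) P0.
rewrite coef0 /P coefB coefZ coefXn eqxx mulr1 coef_sum => /eqP; rewrite subr_eq0 => /eqP <-.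
rewrite big_filter [RHS]big_mkcond big_seq [RHS]big_seq; apply: eq_bigr => t tl.
rewrite coefZ coefXn; have -> : (M == M + d0 t - d1 t)%N = (d0 t == d1 t).
  by have := dM t tl; lia.
by case: eqP; rewrite ?mulr1 ?mulr0.
Qed.

(** A balanced term has equal degrees in the two columns; multiplying it by a power of the
    determinant, which is 1, raises both to [r]. The matrix comes from the binomial expansion of
    that power. *)
Lemma biform_exists (F : 'M[K]_2 -> S) : sl2_poly F ->
  (forall s t, \det s = 1 -> t != 0 -> F (s *m mx22 t 0 0 t^-1) = F s) ->
  exists M, forall r, (M <= r)%N ->
  exists E : 'M[S]_(r.+1), forall s, \det s = 1 -> F s = biform E s.
Proof.
move=> Fp /(sl2_poly_torus Fp)[l [bal Hl]].
exists (\max_(t <- l) (t.2.1.1 + t.2.1.2))%N => r Mr.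
pose E (t : S * ((nat * nat) * (nat * nat))) : 'M[S]_(r.+1) :=
  let m := (r - (t.2.1.1 + t.2.1.2))%N in
  t.1 *: \sum_(k < m.+1) (((-1) ^+ k *+ 'C(m, k))%:MP *:
    delta_mx (inord (t.2.1.1 + (m - k))) (inord (t.2.2.1 + k))).
exists (\sum_(t <- l) E t) => s ds; rewrite Hl // biform_sum big_seq [RHS]big_seq.
apply: eq_bigr => t tl.
have dr : (t.2.1.1 + t.2.1.2 <= r)%N.
  by apply: leq_trans Mr; apply: (@leq_bigmax_seq _ l predT (fun t => t.2.1.1 + t.2.1.2)%N).
have := bal t tl; rewrite /E; case: t dr {tl} => c [[a b] [a' b']] /= dr bal'.
set m := (r - (a + b))%N; rewrite biformZ biform_sum -mul_mpolyC mulrC; congr (_ * _).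
have -> : entry_mono ((a, b), (a', b')) s
   = entry_mono ((a, b), (a', b')) s * (s 0 0 * s 1 1 - s 0 1 * s 1 0) ^+ m.
  by rewrite -det22 ds expr1n mulr1.
rewrite exprBn mulr_sumr rmorph_sum; apply: eq_bigr => k _.
rewrite biformZ biform_delta -rmorphM /=; congr (_%:MP).
have km : (k <= m)%N by rewrite -ltnS.
rewrite !inordK; try by rewrite /m in km *; lia.
rewrite /entry_mono /=.
have -> : (r - (a + (m - k)) = b + k)%N by rewrite /m in km *; lia.
have -> : (r - (a' + k) = b' + (m - k))%N by rewrite /m in km *; lia.
rewrite mulrnAl mulrnAr !exprD !exprMn; congr (_ *+ _).
move: (s 0 0 ^+ a) (s 0 0 ^+ (m - k)) (s 1 0 ^+ b) (s 1 0 ^+ k) (s 0 1 ^+ a') (s 0 1 ^+ k)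
  (s 1 1 ^+ b') (s 1 1 ^+ (m - k)) ((-1 : K) ^+ k) => *; ring.
Qed.

End BilinearForms.

(** * Invariant determinants *)

Section GeometricReductivity.

Variables (K : closedFieldType) (n p : nat) (G : 'M[K]_2 -> Prop) (rho : 'M[K]_2 -> 'M[K]_n).
Local Notation S := {mpoly K[n]}.
Local Notation act := (poly_act rho).
Local Notation R := (invariant_ring G rho).
Local Notation C := (@mpolyC n K).

Hypotheses (charKp : p \in [pchar K]) (closedG : closed_subgroup_GL G).
Hypotheses (SL2G : forall s : 'M[K]_2, \det s = 1 -> G s) (modG : Gmodule G rho).

Let actM := poly_actM closedG modG.

Definition anti_mx r : 'M[S]_(r.+1) := \sum_k delta_mx (rev_ord k) k.

(** With [A - B] the determinant and [q = p^e], additivity of the [q]-th power gives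
    [(A - B)^(q-1) = (A^q - B^q) / (A - B)], the sum of all [A^(r-k) B^k]; so [anti_mx] represents
    [det^r]. *)
Lemma biform_anti r e s : r.+1 = (p ^ e)%N -> \det s = 1 -> biform (anti_mx r) s = 1.
Proof.
move=> rp ds; rewrite /anti_mx biform_sum.
set A := s 0 0 * s 1 1; set B := s 0 1 * s 1 0.
have AB : A - B = 1 by rewrite -ds det22.
have : A ^+ r.+1 - B ^+ r.+1 = 1.
  have -> : A = 1 + B by rewrite -AB subrK.
  rewrite exprDn_pchar ?expr1n ?addrK // rp pnatX pnatE ?charKp //.
  by case/andP: charKp.
rewrite subrXX AB mul1r => /(congr1 C); rewrite rmorph1 rmorph_sum => <-.
apply: eq_bigr => k _; rewrite biform_delta /entry_mono /= subSS; congr (_%:MP).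
have -> : (r - (r - k) = k)%N by rewrite subKn // -ltnS.
by rewrite /A /B !exprMn; ring.
Qed.

Lemma det_anti_mx r : \det (anti_mx r) * \det (anti_mx r) = 1.
Proof.
have JJ : anti_mx r *m anti_mx r = 1%:M.
  rewrite mulmx_suml; under eq_bigr do rewrite mulmx_sumr.
  rewrite (eq_bigr (fun k => delta_mx (rev_ord k) (rev_ord k))) => [|k _].
    rewrite (reindex_inj rev_ord_inj) /=.
    under eq_bigr do rewrite rev_ordK; apply/matrixP => i j.
    rewrite summxE (bigD1 i) //= !mxE eqxx big1 ?addr0 => [|k ki]; first by rewrite eq_sym.
    by rewrite mxE eq_sym (negPf ki).
  rewrite (bigD1 (rev_ord k)) //= rev_ordK mul_delta_mx big1 ?addr0 // => l lk.
  rewrite mul_delta_mx_0 //; apply: contraNneq lk => ->.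
  by rewrite rev_ordK.
by rewrite -det_mulmx JJ det1.
Qed.

Lemma biform_act r (E : 'M[S]_(r.+1)) t s :
  biform (map_mx (act t) E) s = act t (biform E s).
Proof.
rewrite /biform; set u := bin_mono _ _ _; set w := bin_mono r (s 0 1)%:MP _.
have fixW a b : map_mx (act t) (bin_mono r a%:MP b%:MP) = bin_mono r a%:MP b%:MP.
  by apply/colP => i; rewrite !mxE rmorphM !rmorphXn /= !poly_actC.
by rewrite -{1}[u]fixW -{1}[w]fixW map_trmx -!map_mxM mxE.
Qed.

(** For [t] in SL_2, [t] acts on [E] by the congruence with [bin_act r t]. The same congruence fixes
    [anti_mx], whose determinant is nonzero, so the square of [\det (bin_act r t)] is 1. *)
Lemma det_biform_invariant r e (E : 'M[S]_(r.+1)) f : r.+1 = (p ^ e)%N ->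
  (forall s, \det s = 1 -> act s f = biform E s) ->
  (forall z : K, G z%:M -> act z%:M f = f) -> R (\det E).
Proof.
move=> rp fE zf s Gs.
have us := closed_subgroup_unit closedG Gs.
have d0 : \det s != 0 by rewrite -unitfE -unitmxE.
(* A square root of the determinant splits [s] into a scalar and an element of SL_2, and the scalar
   again belongs to [G]. *)
have [z z2] : exists z, z ^+ 2 = \det s.
  have /closed_rootP[z] : size ('X^2 - (\det s)%:P) != 1%N by rewrite size_XnsubC.
  by rewrite rootE !hornerE subr_eq0 => /eqP; exists z.
have z0 : z != 0 by apply: contraNneq d0 => E0; rewrite -z2 E0 expr0n.
pose t := z^-1 *: s.
have dt : \det t = 1 by rewrite /t detZ exprVn z2 mulVf.
have Gt := SL2G dt.
have Es : s = z%:M *m t by rewrite mul_scalar_mx scalerA mulfV ?scale1r.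
have Gz : G z%:M.
  have -> : z%:M = s *m invmx t by rewrite Es -mulmxA mulmxV ?mulmx1 // det_unit1.
  by case: closedG => _ _ GM Ginv; apply: GM => //; apply: Ginv.
have tE : map_mx (act t) E = (map_mx C (bin_act r t))^T *m E *m map_mx C (bin_act r t).
  apply: biform_uniq => s' ds'; rewrite biform_act -fE // -actM //; last exact: SL2G.
  by rewrite fE ?biform_mul // det_mulmx dt ds' mul1r.
have tJ : anti_mx r = (map_mx C (bin_act r t))^T *m anti_mx r *m map_mx C (bin_act r t).
  apply: biform_uniq => s' ds'; rewrite -biform_mul !(biform_anti rp) //.
  by rewrite det_mulmx dt ds' mul1r.
have zE : map_mx (act z%:M) E = E.
  apply: biform_uniq => s' ds'; rewrite biform_act -fE // -actM //; last exact: SL2G.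
  by rewrite -scalar_mxC actM ?zf //; apply: SL2G.
rewrite Es actM // -!det_map_mx tE map_mxM map_mxM.
have fixC (M : 'M[K]_(r.+1)) : map_mx (act z%:M) (map_mx C M) = map_mx C M.
  by apply/matrixP => i j; rewrite !mxE poly_actC.
rewrite -map_trmx !fixC zE.
move: (congr1 (fun M => \det M) tJ); rewrite !det_mulmx det_tr => HJ.
suff E1 : \det (map_mx C (bin_act r t)) * \det (map_mx C (bin_act r t)) = 1.
  by rewrite mulrAC E1 mul1r.
have J0 : \det (anti_mx r) != 0.
  by apply: contra_eq_neq (det_anti_mx r) => ->; rewrite mul0r eq_sym oner_eq0.
by apply: (mulIf J0); rewrite mul1r [in RHS]HJ mulrAC.
Qed.

Lemma det_addZ (T : comNzRingType) k (x : T) (A B : 'M[T]_k) :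
  exists c, \det (A + x *: B) = \det A + x * c.
Proof.
pose P (a b : T) := exists c, a = b + x * c.
apply: (big_ind2 P) => [|a b a' b' [c ->] [c' ->]|s _].
- by exists 0; rewrite mulr0 addr0.
- by exists (c + c'); ring.
have [c ->] : P (\prod_i (A + x *: B) i (s i)) (\prod_i A i (s i)).
  apply: (big_ind2 P) => [|a b a' b' [c ->] [c' ->]|i _].
  - by exists 0; rewrite mulr0 addr0.
  - by exists (b * c' + c * b' + x * c * c'); ring.
  by exists (B i (s i)); rewrite !mxE.
by exists ((-1) ^+ s * c); rewrite mulrDr [x * (_ * _)]mulrCA.
Qed.

Variable v : 'I_3 -> 'I_n.
Hypotheses (Rv : forall i, R 'X_(v i)).
Hypothesis diagG : forall t, G t -> is_diag_mx t -> is_diag_mx (rho t).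

Lemma poly_act_diagX t m : G t -> is_diag_mx t ->
  act t 'X_[m] = (\prod_i rho (invmx t) i i ^+ m i) *: 'X_[m].
Proof.
move=> Gt dt; have ut := closed_subgroup_unit closedG Gt.
have dit : is_diag_mx (rho (invmx t)).
  apply: diagG; last exact: is_diag_invmx.
  by case: closedG => _ _ _; apply.
rewrite mpolyXE_id rmorph_prod -mul_mpolyC rmorph_prod -big_split /=.
apply: eq_bigr => i _; rewrite rmorphXn /= poly_actX (bigD1 i) //= big1 ?addr0 => [|j ji].
  by rewrite exprZn -mul_mpolyC.
by move/is_diag_mxP: dit => ->; rewrite ?scale0r // eq_sym.
Qed.

Lemma mcoeff_poly_act_diag t f m : G t -> is_diag_mx t ->
  (act t f)@_m = (\prod_i rho (invmx t) i i ^+ m i) * f@_m.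
Proof.
move=> Gt dt; rewrite {1}[f]mpolyE (raddf_sum (act t)) (raddf_sum (mcoeff m)) /=.
rewrite (eq_bigr (fun m' : 'X_{1..n} => (\prod_i rho (invmx t) i i ^+ m' i) * f@_m' *+ (m' == m))).
  have [mf|mf] := boolP (m \in msupp f).
    rewrite (bigD1_seq m) ?msupp_uniq //= eqxx mulr1n [X in _ + X]big1 ?addr0 // => m' /negPf->.
    by rewrite mulr0n.
  rewrite (memN_msupp_eq0 mf) mulr0 big1_seq // => m' /andP[_ m'f].
  by case: eqP => [E|]; rewrite ?mulr0n // -E m'f in mf *.
move=> m' _; rewrite /= poly_actZ poly_act_diagX // scalerA mcoeffZ mcoeffX mulr_natr.
by rewrite mulrC.
Qed.

(* Monomialwise division preserves invariance under the diagonal matrices of [G]. *)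
Lemma vars_ideal_quotients h : R h -> in_vars_ideal v h ->
  exists h' : 'I_3 -> S, h = \sum_i 'X_(v i) * h' i /\
    forall i t, G t -> is_diag_mx t -> act t (h' i) = h' i.
Proof.
move=> Rh hI.
(* Each monomial of [h] is assigned one of the variables dividing it; the default [ord0] is never
   reached on the support of [h]. *)
pose ix (m : 'X_{1..n}) := odflt ord0 [pick i | m (v i) != 0%N].
have ixP m : m \in msupp h -> m (v (ix m)) != 0%N.
  move=> mh; rewrite /ix; case: pickP => [//|H].
  move: mh; rewrite mcoeff_msupp hI ?eqxx // => i.
  by have /negbFE/eqP := H i.
pose h' i := \sum_(m <- msupp h | ix m == i) h@_m *: 'X_[m - U_(v i)] : S.
exists h'; split=> [|i t Gt dt].
  rewrite {1}[h]mpolyE (partition_big ix predT) //=; apply: eq_bigr => i _.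
  rewrite /h' mulr_sumr big_seq_cond [RHS]big_seq_cond; apply: eq_bigr => m /andP[mh /eqP im].
  by rewrite -scalerAr -mpolyXD addmC submK // lep1mP -im ixP.
rewrite /h' (raddf_sum (act t)) /= big_seq_cond [RHS]big_seq_cond; apply: eq_bigr => m /andP[mh /eqP im].
rewrite /= poly_actZ; congr (_ *: _).
(* Diagonal elements scale monomials, so each monomial occurring in the invariant [h] is fixed by
   them. *)
have Rm : act t 'X_[m] = 'X_[m].
  rewrite poly_act_diagX // -[RHS]scale1r; congr (_ *: _).
  move: mh; rewrite mcoeff_msupp => hm; apply: (mulIf hm).
  by rewrite -mcoeff_poly_act_diag // Rh // mul1r.
apply: (mulfI (mpolyX_neq0 K U_(v i))).
by rewrite -{1}(Rv i Gt) -rmorphM /= -mpolyXD addmC submK // lep1mP -im ixP.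
Qed.

(** The determinant of the form of [h] is [h^(r+1)] up to sign. Removing the summands
    ['X_(v i) *: E i] one at a time changes it by multiples of ['X_(v i)], and since all
    intermediate determinants are invariant, so are the cofactors. *)
Lemma invariant_radical h : R h -> in_vars_ideal v h ->
  exists N (c : 'I_3 -> S), (forall i, R (c i)) /\ h ^+ N = \sum_i 'X_(v i) * c i.
Proof.
move=> Rh /(vars_ideal_quotients Rh)[h' [Eh h'T]].
have exE i : exists M, forall r, (M <= r)%N -> exists E : 'M[S]_(r.+1),
    forall s, \det s = 1 -> act s (h' i) = biform E s.
  apply: (@biform_exists K n (fun s => act s (h' i))); first exact: sl2_poly_act SL2G modG.
  move=> s t ds t0; have dt : \det (mx22 t 0 0 t^-1) = 1.
    by rewrite det22 !mxE /= mulr0 subr0 mulfV.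
  rewrite actM; try exact: SL2G.
  congr (act s _); apply: h'T; first exact: SL2G.
  by apply/is_diag_mxP => a b; rewrite mxE; case: (ord2P a) (ord2P b) => -> [] ->.
have [M HM] := @seq_choice 'I_3 nat 0%N (enum 'I_3) _ (fun i _ => exE i).
have p1 : (1 < p)%N by case/andP: charKp => /prime_gt1.
(* The size [r + 1] must be a power of [p], with [r] large enough for all three quotients at
   once. *)
pose e := (\max_(i < 3) M i).+1; pose r := (p ^ e).-1.
have rp : r.+1 = (p ^ e)%N by rewrite prednK // expn_gt0 ltnW.
have Mr i : (M i <= r)%N.
  rewrite -ltnS rp; apply: leq_trans (ltnW (ltn_expl _ p1)); rewrite ltnS.
  exact: leq_bigmax.
have [E HE] := @seq_choice 'I_3 'M[S]_(r.+1) 0 (enum 'I_3)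
  (fun i E => forall s, \det s = 1 -> act s (h' i) = biform E s)
  (fun i ii => HM i ii r (Mr i)).
have {}HE i s : \det s = 1 -> act s (h' i) = biform (E i) s.
  by move=> ds; apply: HE; rewrite ?mem_enum.
pose F k : 'M[S]_(r.+1) := \sum_(i < 3 | (k <= i)%N) 'X_(v i) *: E i.
have RF k : R (\det (F k)).
  apply: (@det_biform_invariant r e _ (\sum_(i < 3 | (k <= i)%N) 'X_(v i) * h' i)) => // [s ds|z Gz].
    rewrite (raddf_sum (act s)) /= /F -big_filter -[in RHS]big_filter biform_sum; apply: eq_bigr => i _.
    by rewrite rmorphM /= HE // Rv ?biformZ //; apply: SL2G.
  rewrite (raddf_sum (act z%:M)) /=; apply: eq_bigr => i _.
  by rewrite rmorphM /= Rv // h'T // scalar_mx_is_diag.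
(* As [h] is invariant, its translates are [h] times [det^r]; uniqueness of the matrix identifies
   the two forms. *)
have F0 : F 0%N = h *: anti_mx r.
  apply: biform_uniq => s ds; rewrite biformZ (biform_anti rp) // mulr1.
  rewrite -[RHS](Rh s (SL2G ds)) [in RHS]Eh (raddf_sum (act s)) /= /F biform_sum; apply: eq_bigr => i _.
  by rewrite rmorphM /= HE // Rv ?biformZ //; apply: SL2G.
have FS (i : 'I_3) : F i = F i.+1 + 'X_(v i) *: E i.
  rewrite /F (bigD1 i) //= addrC; congr (_ + _); apply: eq_bigl => j.
  by rewrite ltn_neqAle andbC eq_sym.
have dF (i : 'I_3) : exists c, \det (F i) = \det (F i.+1) + 'X_(v i) * c.
  by rewrite FS; apply: det_addZ.
have [c Hc] := @seq_choice 'I_3 S 0 (enum 'I_3) _ (fun i _ => dF i).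
have {}Hc i := Hc i (mem_enum _ i).
have sR := (invariant_subalgebra G rho).1.
have Rc i : R (c i).
  apply: (@invariant_div _ _ _ G rho 'X_(v i)) => //; first exact: mpolyX_neq0.
  have -> : 'X_(v i) * c i = \det (F i) - \det (F i.+1) by rewrite Hc addrAC subrr add0r.
  exact: (subringB sR (RF _) (RF _)).
have F3 : F 3%N = 0 by rewrite /F big_pred0 // => i; rewrite leqNgt ltn_ord.
have dF0 : \det (F 0%N) = \sum_i 'X_(v i) * c i.
  have H0 := Hc ord0; have H1 := Hc (lift ord0 ord0).
  have H2 := Hc (lift ord0 (lift ord0 ord0)).
  rewrite /= /bump /= ?add1n F3 det0 add0r in H0 H1 H2.
  by rewrite H0 H1 H2 !big_ord_recl big_ord0 addr0; ring.
have RJ : R (\det (anti_mx r)).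
  apply: (@det_biform_invariant r e _ 1) => // [s ds|z _]; last exact: rmorph1.
  by rewrite (biform_anti rp) // rmorph1.
(* Multiplying by [\det (anti_mx r)], an invariant with square 1, cancels the sign. *)
exists r.+1, (fun i => \det (anti_mx r) * c i); split=> [i|]; first exact: (subringM sR RJ (Rc i)).
under eq_bigr do rewrite mulrCA; rewrite -mulr_sumr -dF0 F0 detZ mulrCA.
by rewrite det_anti_mx mulr1.
Qed.

End GeometricReductivity.

Theorem annihilated_cocycle_not_cm (K : closedFieldType) (n p : nat)
    (G : 'M[K]_2 -> Prop) (rho : 'M[K]_2 -> 'M[K]_n) (v : 'I_3 -> 'I_n)
    (g : 'M[K]_2 -> {mpoly K[n]}) (b : 'I_3 -> {mpoly K[n]}) :
  p \in [pchar K] -> closed_subgroup_GL G -> (forall s : 'M[K]_2, \det s = 1 -> G s) ->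
  Gmodule G rho -> (forall t, G t -> is_diag_mx t -> is_diag_mx (rho t)) ->
  injective v -> (forall i, invariant_ring G rho 'X_(v i)) ->
  (forall i s, G s -> 'X_(v i) * g s = poly_act rho s (b i) - b i) ->
  ~ coboundary G rho g -> ~ cohen_macaulay (invariant_ring G rho).
Proof.
move=> charKp closedG SL2G modG diagG vI Rv gb ncob cm; apply: ncob.
have aR := invariant_subalgebra G rho; have sR := aR.1.
have Rdiv k x : invariant_ring G rho 'X_k -> invariant_ring G rho ('X_k * x) ->
    invariant_ring G rho x by apply: invariant_div; apply: mpolyX_neq0.
pose a i : {mpoly K[n]} := 'X_(v (inord i)); pose b' i := b (inord i).
pose u i j := a i * b' j - a j * b' i.
have act_b i s : G s -> poly_act rho s (b' i) = b' i + a i * g s.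
  by move=> Gs; rewrite gb // addrC subrK.
have Ru i j : invariant_ring G rho (u i j).
  move=> s Gs; rewrite /u rmorphB !rmorphM /= !act_b // /a !Rv //.
  by ring.
(* The witnesses come from [a_2 u_01 = a_0 u_21 + a_1 u_02]. *)
have [|x [y [Rx Ry Eu]]] := @cm_unmixed K n _ v aR vI Rv Rdiv
    (invariant_radical charKp closedG SL2G modG Rv diagG) (u 0 1)%N cm (Ru _ _).
  exists (u 2 1)%N, (u 0 2)%N; split=> //; rewrite -!/(a _) /u.
  by ring.
(* So [a_0] divides [b_0 + y]. As [y] is invariant, the coboundary of the quotient, multiplied by
   [a_0], is that of [b_0], namely [a_0 g]. *)
have E : a 1%N * (b' 0%N + y) = a 0%N * (b' 1%N - x).
  move: Eu; rewrite /u -!/(a _) => Eu.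
  have -> : a 1%N * (b' 0%N + y) = a 0%N * b' 1%N - (a 0%N * b' 1%N - a 1%N * b' 0%N)
      + a 1%N * y by ring.
  by rewrite Eu; ring.
have v10 : v (inord 1) != v (inord 0) by rewrite (inj_eq vI) -val_eqE /= !inordK.
have [z _ Ez] := @regular_pair_vars K n (fun _ => True) _ _ v10 (fun _ _ _ _ => I) I _ _ I I E.
exists z => s Gs; apply: (mulfI (mpolyX_neq0 K U_(v (inord 0)))).
rewrite gb // mulrBr -{1}(Rv (inord 0) s Gs) -rmorphM /= -Ez rmorphD /= (Ry s Gs).
by rewrite opprD addrACA subrr addr0.
Qed.

(** * The module of dimension 7p - 2 *)

Section RegularFunctions.

Variables (K : closedFieldType) (G : 'M[K]_2 -> Prop).
Hypothesis closedG : closed_subgroup_GL G.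
Implicit Types f h : 'M[K]_2 -> K.

Lemma regular_eq f h : (forall s, G s -> f s = h s) -> regular_on G h -> regular_on G f.
Proof. by move=> fh [q [k H]]; exists q, k => s Gs; rewrite fh ?H. Qed.

Lemma regular_poly (q : {mpoly K[2 * 2]}) : regular_on G (meval_mx q).
Proof. by exists q, 0%N => s _; rewrite expr0 divr1. Qed.

Lemma regular_const c : regular_on G (fun _ => c).
Proof. by apply: regular_eq (regular_poly c%:MP) => s _; rewrite /meval_mx mevalC. Qed.

Lemma regular_entry i j : regular_on G (fun s => s i j).
Proof.
apply: regular_eq (regular_poly 'X_(mxvec_index i j)) => s _.
by rewrite /meval_mx mevalXU mxvecE.
Qed.

Lemma regularM f h : regular_on G f -> regular_on G h -> regular_on G (fun s => f s * h s).
Proof.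
move=> [q [k Hf]] [q' [k' Hh]]; exists (q * q'), (k + k')%N => s Gs.
by rewrite Hf ?Hh // /meval_mx mevalM exprD invfM mulrACA.
Qed.

Let det_poly : {mpoly K[2 * 2]} :=
  'X_(mxvec_index 0 0) * 'X_(mxvec_index 1 1) - 'X_(mxvec_index 0 1) * 'X_(mxvec_index 1 0).

Let meval_det s : meval_mx det_poly s = \det s.
Proof. by rewrite /meval_mx mevalB !mevalM !mevalXU !mxvecE det22. Qed.

Let det_neq0 s : G s -> \det s != 0.
Proof. by move=> /(closed_subgroup_unit closedG); rewrite unitmxE unitfE. Qed.

Lemma regularD f h : regular_on G f -> regular_on G h -> regular_on G (fun s => f s + h s).
Proof.
move=> [q [k Hf]] [q' [k' Hh]].
exists (q * det_poly ^+ k' + q' * det_poly ^+ k), (k + k')%N => s Gs.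
have d0 := det_neq0 Gs.
rewrite Hf ?Hh // /meval_mx mevalD !mevalM !rmorphXn /= -!/(meval_mx _ s) meval_det exprD.
by field; rewrite !expf_neq0.
Qed.

Lemma regular_sum (I : Type) (r : seq I) (P : pred I) (F : I -> 'M[K]_2 -> K) :
  (forall i, regular_on G (F i)) -> regular_on G (fun s => \sum_(i <- r | P i) F i s).
Proof.
move=> HF; elim: r => [|i r IH].
  by apply: regular_eq (regular_const 0) => s _; rewrite big_nil.
case Pi: (P i); last by apply: regular_eq IH => s _; rewrite big_cons Pi.
by apply: regular_eq (regularD (HF i) IH) => s _; rewrite big_cons Pi.
Qed.

Lemma regular_exp f k : regular_on G f -> regular_on G (fun s => f s ^+ k).
Proof.
move=> Hf; elim: k => [|k IH]; first exact: regular_const.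
by apply: regular_eq (regularM Hf IH) => s _; rewrite exprS.
Qed.

Lemma regular_prod (I : Type) (r : seq I) (F : I -> 'M[K]_2 -> K) :
  (forall i, regular_on G (F i)) -> regular_on G (fun s => \prod_(i <- r) F i s).
Proof.
move=> HF; elim: r => [|i r IH].
  by apply: regular_eq (regular_const 1) => s _; rewrite big_nil.
by apply: regular_eq (regularM (HF i) IH) => s _; rewrite big_cons.
Qed.

Lemma regular_inv f : regular_on G f -> regular_on G (fun s => f (invmx s)).
Proof.
move=> [q [k Hf]].
have reg_det : regular_on G (fun s => \det s).
  by apply: regular_eq (regular_poly det_poly) => s _; rewrite meval_det.
have reg_idet : regular_on G (fun s => (\det s)^-1).
  by exists 1, 1%N => s _; rewrite /meval_mx meval1 mul1r expr1.
have reg_ent i j : regular_on G (fun s => invmx s i j).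
  have ent a b c d : regular_on G a -> regular_on G b -> regular_on G c -> regular_on G d ->
      regular_on G (fun s => (\det s)^-1 * mx22 (a s) (b s) (c s) (d s) i j).
    move=> Ha Hb Hc Hd; apply: regularM => //.
    case: (ord2P i) (ord2P j) => -> [] ->; [move: Ha | move: Hb | move: Hc | move: Hd];
      by apply: regular_eq => s _; rewrite mxE.
  have neg a b : regular_on G (fun s => - s a b).
    apply: regular_eq (regularM (regular_const (-1)) (regular_entry a b)) => s _.
    by rewrite mulN1r.
  apply: regular_eq (ent _ _ _ _ (regular_entry 1 1) (neg 0 1) (neg 1 0) (regular_entry 0 0)).
  by move=> s Gs; rewrite invmx22 ?(closed_subgroup_unit closedG) // mxE.
apply: (@regular_eq _ (fun s => (\sum_(m <- msupp q) q@_m *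
    \prod_i mxvec (invmx s) 0 i ^+ m i) * \det s ^+ k)).
  move=> s Gs; have Gi : G (invmx s) by case: closedG => _ _ _; apply.
  by rewrite Hf // /meval_mx mevalE det_inv exprVn invrK.
apply: regularM; last exact: regular_exp.
apply: regular_sum => m; apply: regularM; first exact: regular_const.
apply: regular_prod => i; apply: regular_exp; case/mxvec_indexP: i => i j.
by apply: regular_eq (reg_ent i j) => s _; rewrite mxvecE.
Qed.

Lemma regular_bin_act r i k : regular_on G (fun s => bin_act r s i k).
Proof.
pose P (F : 'M[K]_2 -> {poly K}) := forall k, regular_on G (fun s => (F s)`_k).
have PM F F' : P F -> P F' -> P (fun s => F s * F' s).
  move=> HF HF' l; apply: (@regular_eq _ (fun s => \sum_(j < l.+1) (F s)`_j * (F' s)`_(l - j))).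
    by move=> s _; rewrite coefM.
  by apply: regular_sum => j; apply: regularM.
have PX F j : P F -> P (fun s => F s ^+ j).
  move=> HF; elim: j => [|j IH] l.
    by apply: regular_eq (regular_const ((1 : {poly K})`_l)) => s _; rewrite expr0.
 
  by apply: regular_eq (PM _ _ HF IH l) => s _; rewrite exprS.
have Plin a b a' b' : P (fun s => s a b *: 'X + (s a' b')%:P).
  move=> l; apply: (@regular_eq _ (fun s => s a b * (l == 1%N)%:R + s a' b' * (l == 0%N)%:R)).
    by move=> s _; rewrite coefD coefZ coefX coefC; case: (l == 0%N); rewrite ?mulr1 ?mulr0.
  by apply: regularD; apply: regularM; (exact: regular_entry || exact: regular_const).
apply: (@regular_eq _ (fun s => ((s 0 0 *: 'X + (s 0 1)%:P) ^+ i
  * (s 1 0 *: 'X + (s 1 1)%:P) ^+ (r - i))`_k)) => [s _|]; first by rewrite mxE.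
by apply: PM; apply: PX.
Qed.

End RegularFunctions.

(** * Constructions of modules with a weight basis *)

Section Representations.

Variables (K : closedFieldType) (G : 'M[K]_2 -> Prop).
Hypothesis closedG : closed_subgroup_GL G.

(* Modules with a basis of weight vectors for the diagonal matrices in [G],
   given by matrices indexed by an arbitrary finite type. *)
Definition weight_rep (A : finType) (M : 'M[K]_2 -> A -> A -> K) : Prop :=
  [/\ forall i j, M 1%:M i j = (i == j)%:R,
      forall s t i j, G s -> G t -> M (s *m t) i j = \sum_k M s i k * M t k j,
      forall i j, regular_on G (fun s => M s i j)
    & forall t i j, G t -> is_diag_mx t -> i != j -> M t i j = 0].

Let Ginv s : G s -> G (invmx s). Proof. by case: closedG => _ _ _; apply. Qed.

Definition rep_sum (A B : finType) (M : 'M[K]_2 -> A -> A -> K) (N : 'M[K]_2 -> B -> B -> K)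
    (s : 'M[K]_2) (i j : A + B) : K :=
  match i, j with inl i, inl j => M s i j | inr i, inr j => N s i j | _, _ => 0 end.

Lemma weight_rep_sum (A B : finType) (M : 'M[K]_2 -> A -> A -> K) N :
  weight_rep M -> weight_rep (N : 'M[K]_2 -> B -> B -> K) -> weight_rep (rep_sum M N).
Proof.
move=> [M1 MM Mr Md] [N1 NM Nr Nd]; split.
- by move=> [i|i] [j|j] /=; rewrite ?M1 ?N1.
- move=> s t [i|i] [j|j] Gs Gt; rewrite big_sumType /=.
  + by rewrite MM // [X in _ + X]big1 ?addr0 // => k _; rewrite mul0r.
  + by rewrite -[LHS]addr0; congr (_ + _); apply/esym/big1 => k _; rewrite ?mul0r ?mulr0.
  + by rewrite -[LHS]addr0; congr (_ + _); apply/esym/big1 => k _; rewrite ?mul0r ?mulr0.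
  + by rewrite NM // [X in X + _]big1 ?add0r // => k _; rewrite mul0r.
- by move=> [i|i] [j|j] /=; try exact: regular_const.
- by move=> t [i|i] [j|j] //= Gt dt ij; [apply: Md | apply: Nd].
Qed.

Definition rep_copies (J A : finType) (M : 'M[K]_2 -> A -> A -> K)
    (s : 'M[K]_2) (i j : J * A) : K := (i.1 == j.1)%:R * M s i.2 j.2.

Lemma weight_rep_copies (J A : finType) (M : 'M[K]_2 -> A -> A -> K) :
  weight_rep M -> weight_rep (@rep_copies J A M).
Proof.
move=> [M1 MM Mr Md]; split.
- by move=> [k i] [l j]; rewrite /rep_copies /= M1 -natrM mulnb.
- move=> s t [k i] [l j] Gs Gt; rewrite /rep_copies /= MM //.
  rewrite -(pair_bigA _ (fun k' i' => (k == k')%:R * M s i i' * ((k' == l)%:R * M t i' j))) /=.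
  rewrite (bigD1 k) //= [X in _ = _ + X]big1 ?addr0 => [|k' k'k].
    by rewrite mulr_sumr; apply: eq_bigr => i' _; rewrite eqxx mul1r mulrCA.
  by rewrite big1 // => i' _; rewrite eq_sym (negPf k'k) !mul0r.
- move=> [k i] [l j]; apply: regularM => //; exact: regular_const.
- move=> t [k i] [l j] Gt dt ij; rewrite /rep_copies /=; case: eqP => [kl|_]; last by rewrite mul0r.
  by rewrite mul1r Md //; apply: contraNneq ij => ->; rewrite kl.
Qed.

(** The extension of the trivial module by [M] with cocycle [c]. The row [None] is trivial, so the
    coordinate [None] is an invariant linear form. *)
Definition rep_ext (A : finType) (M : 'M[K]_2 -> A -> A -> K) (c : 'M[K]_2 -> A -> K)
    (s : 'M[K]_2) (i j : option A) : K :=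
  match i, j with
  | None, None => 1
  | None, Some _ => 0
  | Some i, None => c s i
  | Some i, Some j => M s i j
  end.

Lemma weight_rep_ext (A : finType) (M : 'M[K]_2 -> A -> A -> K) c :
  weight_rep M -> (forall i, c 1%:M i = 0) ->
  (forall s t i, G s -> G t -> c (s *m t) i = c s i + \sum_k M s i k * c t k) ->
  (forall i, regular_on G (fun s => c s i)) ->
  (forall t i, G t -> is_diag_mx t -> c t i = 0) -> weight_rep (rep_ext M c).
Proof.
have big_option (B : finType) (F : option B -> K) :
    \sum_i F i = F None + \sum_i F (Some i).
  rewrite (bigD1 None) //=; congr (_ + _).
  rewrite (reindex_omap Some id) => [|[]] //=.
  by apply: eq_bigl => i; rewrite eqxx.
move=> [M1 MM Mr Md] c1 cM cr cd; split.
- by move=> [i|] [j|] /=; rewrite ?c1 ?M1.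
- move=> s t [i|] [j|] Gs Gt; rewrite big_option /=.
  + by rewrite mulr0 add0r MM.
  + by rewrite mulr1 cM.
  + by rewrite mulr0 add0r big1 // => k _; rewrite mul0r.
  + by rewrite mulr1 big1 ?addr0 // => k _; rewrite mul0r.
- by move=> [i|] [j|] //=; exact: regular_const.
- by move=> t [i|] [j|] //= Gt dt ij; [apply: Md | apply: cd].
Qed.

Definition rep_dual (A : finType) (M : 'M[K]_2 -> A -> A -> K) (s : 'M[K]_2) (i j : A) : K :=
  M (invmx s) j i.

Lemma weight_rep_dual (A : finType) (M : 'M[K]_2 -> A -> A -> K) :
  weight_rep M -> weight_rep (rep_dual M).
Proof.
move=> [M1 MM Mr Md]; split.
- by move=> i j; rewrite /rep_dual invmx1 M1 eq_sym.
- move=> s t i j Gs Gt; rewrite /rep_dual invmxM ?(closed_subgroup_unit closedG) // MM; try exact: Ginv.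
  by apply: eq_bigr => k _; rewrite mulrC.
- by move=> i j; apply: (regular_inv closedG (Mr j i)).
- move=> t i j Gt dt ij; apply: Md; [exact: Ginv | | by rewrite eq_sym].
  by apply: is_diag_invmx dt; apply: (closed_subgroup_unit closedG).
Qed.

Definition rep_tensor (A B : finType) (M : 'M[K]_2 -> A -> A -> K)
    (N : 'M[K]_2 -> B -> B -> K) (s : 'M[K]_2) (i j : A * B) : K :=
  M s i.1 j.1 * N s i.2 j.2.

Lemma weight_rep_tensor (A B : finType) (M : 'M[K]_2 -> A -> A -> K) N :
  weight_rep M -> weight_rep (N : 'M[K]_2 -> B -> B -> K) -> weight_rep (rep_tensor M N).
Proof.
move=> [M1 MM Mr Md] [N1 NM Nr Nd]; split.
- by move=> [i i'] [j j']; rewrite /rep_tensor /= M1 N1 -natrM mulnb.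
- move=> s t [i i'] [j j'] Gs Gt; rewrite /rep_tensor /= MM // NM //.
  rewrite -(pair_bigA _ (fun k k' => M s i k * N s i' k' * (M t k j * N t k' j'))) /=.
  rewrite mulr_suml; apply: eq_bigr => k _; rewrite mulr_sumr; apply: eq_bigr => k' _.
  by rewrite mulrACA.
- by move=> i j; apply: regularM.
- move=> t [i i'] [j j'] Gt dt ij; rewrite /rep_tensor /=.
  have [ii|ii] := eqVneq i j; last by rewrite Md ?mul0r.
  by rewrite Nd ?mulr0 //; apply: contraNneq ij => ->; rewrite ii.
Qed.

Definition rep_mx (A : finType) (M : 'M[K]_2 -> A -> A -> K) (s : 'M[K]_2) : 'M[K]_#|A| :=
  \matrix_(i, j) M s (enum_val i) (enum_val j).

Lemma sum_enum_val (A : finType) (V : nmodType) (F : A -> V) :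
  \sum_(i < #|A|) F (enum_val i) = \sum_i F i.
Proof. by rewrite [RHS](reindex (@enum_val A predT)) //; apply: (onW_bij _ (enum_val_bij _)). Qed.

Lemma Gmodule_rep_mx (A : finType) (M : 'M[K]_2 -> A -> A -> K) :
  weight_rep M -> Gmodule G (rep_mx M).
Proof.
move=> [M1 MM Mr _]; split.
- by apply/matrixP => i j; rewrite !mxE M1 (inj_eq enum_val_inj).
- move=> s t Gs Gt; apply/matrixP => i j; rewrite !mxE MM // -sum_enum_val.
  by apply: eq_bigr => k _; rewrite !mxE.
- by move=> i j; apply: regular_eq (Mr (enum_val i) (enum_val j)) => s _; rewrite mxE.
Qed.

Lemma is_diag_rep_mx (A : finType) (M : 'M[K]_2 -> A -> A -> K) t :
  weight_rep M -> G t -> is_diag_mx t -> is_diag_mx (rep_mx M t).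
Proof.
move=> [_ _ _ Md] Gt dt; apply/is_diag_mxP => i j ij; rewrite mxE Md //.
by rewrite (inj_eq enum_val_inj).
Qed.

End Representations.

(** * Second derivatives at the origin *)

Section Hessian.

Variables (K : closedFieldType) (m n : nat) (rho : 'M[K]_m -> 'M[K]_n).
Local Notation S := {mpoly K[n]}.
Local Notation act := (poly_act rho).

Lemma mpoly_alg_ind (P : S -> Prop) : (forall c, P c%:MP) -> (forall i, P 'X_i) ->
  (forall f h, P f -> P h -> P (f + h)) -> (forall f h, P f -> P h -> P (f * h)) ->
  forall f, P f.
Proof.
move=> PC PX PD PM f; rewrite [f]mpolyE.
have P0 : P 0 by rewrite -(mpolyC0 n K).
have P1 : P 1 by rewrite -(mpolyC1 n K).
apply: (big_ind P P0 PD) => e _; rewrite -mul_mpolyC; apply: (PM) => //.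
rewrite mpolyXE_id; apply: (big_ind P P1 PM) => i _.
by elim: (e i) => [|k IH]; rewrite ?expr0 // exprS; apply: (PM).
Qed.

(** The chain rule for a linear substitution, checked on algebra generators. *)
Lemma mderiv_act s f c :
  (act s f)^`M(c) = \sum_a rho (invmx s) a c *: act s (f^`M(a)).
Proof.
elim/mpoly_alg_ind: f => [k|i|f h IHf IHh|f h IHf IHh].
- by rewrite poly_actC mderivC big1 // => a _; rewrite mderivC rmorph0 scaler0.
- have dX (j k : 'I_n) : ('X_j : S)^`M(k) = (j == k)%:R.
    rewrite mderivX mnm1E; case: eqP => [->|_]; last by rewrite scale0r.
    by rewrite scale1r -{1}[U_(k)%MM]add0m addmK mpolyX0.
  rewrite poly_actX (raddf_sum (mderiv c)) /= (bigD1 c) //= [RHS](bigD1 i) //=.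
  rewrite [X in _ + X = _]big1 => [|a ac]; last by rewrite mderivZ dX (negPf ac) scaler0.
  rewrite [X in _ = _ + X]big1 => [|a ai]; last first.
    by rewrite dX eq_sym (negPf ai) rmorph0 scaler0.
  by rewrite mderivZ !dX !eqxx rmorph_nat.
- rewrite rmorphD !mderivD IHf IHh -big_split /=; apply: eq_bigr => a _.
  by rewrite mderivD rmorphD scalerDr.
rewrite rmorphM mderivM IHf IHh mulr_suml mulr_sumr -big_split /=.
apply: eq_bigr => a _; rewrite mderivM rmorphD !rmorphM /= scalerDr.
by rewrite -scalerAl -scalerAr.
Qed.

Lemma mcoeff0_act s f : (act s f)@_0%MM = f@_0%MM.
Proof.
apply: (@mpoly_rmorph_ext K n _ (mcoeff 0%MM \o act s) (mcoeff 0%MM)) => [c|i] /=.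
  by rewrite poly_actC.
rewrite poly_actX raddf_sum big1 => [|j _]; first by rewrite mcoeffX mnm1_eq0.
by rewrite /= mcoeffZ mcoeffX mnm1_eq0 mulr0.
Qed.

(** Extracts the quadratic part of an arbitrary polynomial equivariantly, so a preimage of a
    quadratic coboundary need not be assumed homogeneous. *)
Definition hessian (f : S) c d : K := (f^`M(c)^`M(d))@_0%MM.

Lemma hessian_act s f c d : hessian (act s f) c d =
  \sum_a \sum_b rho (invmx s) a c * (rho (invmx s) b d * hessian f a b).
Proof.
rewrite /hessian mderiv_act (raddf_sum (mderiv d)) (raddf_sum (mcoeff 0%MM)).
apply: eq_bigr => a _; rewrite /= mderivZ mcoeffZ mderiv_act.
rewrite (raddf_sum (mcoeff 0%MM)) mulr_sumr; apply: eq_bigr => b _.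
by rewrite /= mcoeffZ mcoeff0_act.
Qed.

Lemma hessianE f c d : c != d -> hessian f c d = f@_(U_(c) + U_(d)).
Proof.
move=> cd; rewrite /hessian !mcoeff_mderiv add0m mnm0E mulr1n mnm1E.
by rewrite eq_sym (negPf cd) mulr1n addmC.
Qed.

End Hessian.

(** * Variables as systems of parameters *)

Lemma vars_hsop (K : closedFieldType) n N (w : N.-tuple 'I_n) :
  uniq w -> (forall j, j \in w) ->
  hsop (fun _ : {mpoly K[n]} => True) [tuple of map (fun i => 'X_i : {mpoly K[n]}) w].
Proof.
move=> uw cw; set f := [tuple of _].
have fE i : tnth f i = 'X_(tnth w i) by rewrite tnth_map.
have ltN j : (index j w < N)%N by rewrite -[X in (_ < X)%N](size_tuple w) index_mem.
(* The inverse substitution: it gives algebraic independence and shows that 1 alone generates the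
   module. *)
pose h : n.-tuple {mpoly K[N]} := [tuple 'X_(Ordinal (ltN j)) | j < n].
have fh : cancel (comp_mpoly f) (comp_mpoly h).
  move=> P; apply: (@mpoly_rmorph_ext K N _ (comp_mpoly h \o comp_mpoly f) idfun) => [c|i] /=.
    by rewrite !comp_mpolyC.
  rewrite comp_mpolyXU -tnth_nth fE comp_mpolyXU -tnth_nth tnth_mktuple.
  by congr 'X__; apply: val_inj; rewrite /= (tnth_nth (tnth w i)) index_uniq // size_tuple.
have hf : cancel (comp_mpoly h) (comp_mpoly f).
  move=> P; apply: (@mpoly_rmorph_ext K n _ (comp_mpoly f \o comp_mpoly h) idfun) => [c|j] /=.
    by rewrite !comp_mpolyC.
  rewrite comp_mpolyXU -tnth_nth tnth_mktuple comp_mpolyXU -tnth_nth fE.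
  by congr 'X__; rewrite (tnth_nth j) /= nth_index.
split=> // [i|P /(congr1 (comp_mpoly h))|].
- by exists 1%N; rewrite fE dhomogX; rewrite /= mdeg1.
- by rewrite fh rmorph0.
exists [:: 1] => // r _; exists (fun _ => r \mPo h).
by rewrite big_seq1 mulr1 hf.
Qed.

Lemma vars_partial_hsop (K : closedFieldType) n k (v : k.-tuple 'I_n) : uniq v ->
  partial_hsop (fun _ : {mpoly K[n]} => True) [tuple of map (fun i => 'X_i : {mpoly K[n]}) v].
Proof.
move=> uv; pose o := [seq j <- enum 'I_n | j \notin v].
exists (size o), [tuple of map (fun i => 'X_i) (in_tuple o)].
pose w := [tuple of v ++ in_tuple o].
have uw : uniq w.
  rewrite cat_uniq uv filter_uniq ?enum_uniq // andbT.
  by apply/hasPn => j; rewrite mem_filter => /andP[].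
have cw j : j \in w by rewrite mem_cat mem_filter mem_enum andbT orbN.
have := vars_hsop K uw cw; congr hsop.
by apply: val_inj; rewrite /= map_cat.
Qed.

(** * The p-th power extension and its cocycle *)

Section SymmetricPower.

Variables (K : closedFieldType) (r : nat) (G : 'M[K]_2 -> Prop).
Hypotheses (charK : r.+1 \in [pchar K]) (closedG : closed_subgroup_GL G).

(* [bin_act r.+1] acts on monomials of degree p = r + 1; [eps] indexes x^p and
   y^p, and [mid] the other ones. *)
Definition eps (j : 'I_2) : 'I_r.+2 := if j == 0 then lift ord0 ord_max else ord0.
Definition mid (i : 'I_r) : 'I_r.+2 := lift ord0 (widen_ord (leqnSn r) i).

Lemma mx_mul_eps_mid a b (u : 'I_a -> 'I_r.+2) (w : 'I_b -> 'I_r.+2) (A B : 'M[K]_(r.+2)) :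
  mxsub u w (A *m B) = mxsub u eps A *m mxsub eps w B + mxsub u mid A *m mxsub mid w B.
Proof.
apply/matrixP => i j; rewrite !mxE big_ord_recl big_ord_recr /=.
rewrite [X in _ = X + _]big_ord_recl big_ord1 !mxE.
have -> : eps ord0 = lift ord0 ord_max by [].
have -> : eps (lift ord0 ord0) = ord0 by [].
rewrite [X in _ = _ + X](eq_bigr (fun k => A (u i) (mid k) * B (mid k) (w j))) => [|k _].
  by rewrite addrA addrAC; congr (_ + _); rewrite addrC.
by rewrite !mxE.
Qed.

Lemma mid_inj : injective mid.
Proof. by move=> i i' /(congr1 val) /= [] /val_inj. Qed.

Lemma eps_inj : injective eps.
Proof. by move=> i j; case: (ord2P i) (ord2P j) => -> [] -> // /(congr1 val). Qed.

Lemma eps_mid j i : (eps j == mid i) = false.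
Proof.
rewrite -val_eqE /eps; case: ifP => _ //=.
by rewrite /bump eqSS gtn_eqF.
Qed.

Definition mid_rep (s : 'M[K]_2) : 'M[K]_r := mxsub mid mid (bin_act r.+1 s).
Definition frob_rep (s : 'M[K]_2) : 'M[K]_2 := mxsub eps eps (bin_act r.+1 s).
Definition glue (s : 'M[K]_2) : 'M[K]_(r, 2) := mxsub mid eps (bin_act r.+1 s).
(** The off-diagonal block, composed with the inverse action on the quotient, is the extension
    cocycle with values in Hom(F, A). *)
Definition twist (s : 'M[K]_2) : 'M[K]_(r, 2) := glue s *m frob_rep (invmx s).

(** The [p]-th power is additive, so the rows of [x^p] and [y^p] involve only these two monomials.
    Hence column vectors supported on [mid] form a submodule, and the quotient is the Frobenius
    twist. *)
Lemma bin_act_eps_mid (s : 'M[K]_2) : mxsub eps mid (bin_act r.+1 s) = 0.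
Proof.
have frob (a b : K) : (a *: 'X + b%:P) ^+ r.+1 = (a ^+ r.+1) *: 'X^(r.+1) + (b ^+ r.+1)%:P.
  rewrite exprDn_pchar ?exprZn ?rmorphXn // (eq_pnat _ (@pchar_poly K)) pnatE ?charK //.
  by case/andP: charK.
apply/matrixP => j i; rewrite !mxE.
have im : (mid i == r.+1 :> nat) = false by rewrite /= /bump eqSS ltn_eqF.
rewrite /eps; case: ifP => _ /=.
  by rewrite /bump add1n subnn expr0 mulr1 frob coefD coefZ coefXn coefC im mulr0 addr0.
by rewrite expr0 subn0 mul1r frob coefD coefZ coefXn coefC im mulr0 addr0.
Qed.

Lemma mid_repM s t : mid_rep (s *m t) = mid_rep s *m mid_rep t.
Proof. by rewrite /mid_rep bin_actM mx_mul_eps_mid bin_act_eps_mid mulmx0 add0r. Qed.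

Lemma frob_repM s t : frob_rep (s *m t) = frob_rep s *m frob_rep t.
Proof. by rewrite /frob_rep bin_actM mx_mul_eps_mid bin_act_eps_mid mul0mx addr0. Qed.

Lemma glueM s t : glue (s *m t) = glue s *m frob_rep t + mid_rep s *m glue t.
Proof. by rewrite /glue bin_actM mx_mul_eps_mid. Qed.

Lemma mid_rep1 : mid_rep 1%:M = 1%:M.
Proof. by apply/matrixP => i j; rewrite [LHS]mxE bin_act1 !mxE (inj_eq mid_inj). Qed.

Lemma frob_rep1 : frob_rep 1%:M = 1%:M.
Proof. by apply/matrixP => i j; rewrite [LHS]mxE bin_act1 !mxE (inj_eq eps_inj). Qed.

Lemma glue1 : glue 1%:M = 0.
Proof. by apply/matrixP => i j; rewrite [LHS]mxE bin_act1 !mxE eq_sym eps_mid. Qed.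

Lemma frob_repV s : G s -> frob_rep s *m frob_rep (invmx s) = 1%:M.
Proof. by move=> Gs; rewrite -frob_repM mulmxV ?frob_rep1 // (closed_subgroup_unit closedG). Qed.

Lemma mid_repV s : G s -> mid_rep s *m mid_rep (invmx s) = 1%:M.
Proof. by move=> Gs; rewrite -mid_repM mulmxV ?mid_rep1 // (closed_subgroup_unit closedG). Qed.

Lemma twist1 : twist 1%:M = 0.
Proof. by rewrite /twist glue1 mul0mx. Qed.

Lemma twistM s t : G s -> G t ->
  twist (s *m t) = twist s + mid_rep s *m twist t *m frob_rep (invmx s).
Proof.
move=> Gs Gt; rewrite /twist invmxM ?(closed_subgroup_unit closedG) // frob_repM glueM mulmxDl; congr (_ + _).
  by rewrite !mulmxA -(mulmxA (glue s)) frob_repV // mulmx1.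
by rewrite !mulmxA.
Qed.

Lemma twistV s : G s -> mid_rep s *m twist (invmx s) *m frob_rep (invmx s) = - twist s.
Proof.
move=> Gs; have Gi : G (invmx s) by case: closedG => _ _ _; apply.
apply/eqP; rewrite -addr_eq0 addrC -twistM // mulmxV ?twist1 //.
exact: closed_subgroup_unit Gs.
Qed.

Lemma bin_act_diag_entry (t : 'M[K]_2) i j : is_diag_mx t -> i != j -> bin_act r.+1 t i j = 0.
Proof. by move=> /is_diag_mxP dt; apply/is_diag_mxP/bin_act_diag; apply: dt. Qed.

Lemma twist_diag t : is_diag_mx t -> twist t = 0.
Proof.
move=> dt; rewrite /twist (_ : glue t = 0) ?mul0mx //.
by apply/matrixP => i j; rewrite [LHS]mxE bin_act_diag_entry ?mxE // eq_sym eps_mid.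
Qed.

Lemma weight_rep_mid : weight_rep G (fun s i j => mid_rep s i j).
Proof.
split=> [i j|s t i j _ _|i j|t i j _ dt ij].
- by rewrite mid_rep1 mxE.
- by rewrite mid_repM mxE.
- apply: regular_eq (regular_bin_act closedG (mid i) (mid j)) => s _.
  by rewrite mxE.
by rewrite mxE bin_act_diag_entry // (inj_eq mid_inj).
Qed.

Lemma weight_rep_frob : weight_rep G (fun s i j => frob_rep s i j).
Proof.
split=> [i j|s t i j _ _|i j|t i j _ dt ij].
- by rewrite frob_rep1 mxE.
- by rewrite frob_repM mxE.
- apply: regular_eq (regular_bin_act closedG (eps i) (eps j)) => s _.
  by rewrite mxE.
by rewrite mxE bin_act_diag_entry // (inj_eq eps_inj).
Qed.

Lemma regular_twist i j : regular_on G (fun s => twist s i j).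
Proof.
have [_ _ Hf _] := weight_rep_frob.
apply: (@regular_eq _ _ _ (fun s => \sum_k glue s i k * frob_rep (invmx s) k j)) => [s _|].
  by rewrite mxE.
apply: regular_sum => // k; apply: regularM; last exact: (regular_inv closedG (Hf k j)).
by apply: regular_eq (regular_bin_act closedG (mid i) (eps k)) => s _; rewrite mxE.
Qed.

(* The torus forces an equivariant splitting to vanish on the middle monomials,
   but the substitution x -> x + y, y -> y does not split off x y^(p-1). *)
Lemma twist_not_coboundary (k : 'M[K]_(r, 2)) : (0 < r)%N ->
  ~ forall s, \det s = 1 -> twist s = mid_rep s *m k *m frob_rep (invmx s) - k.
Proof.
move=> r0 H.
have Hg s : \det s = 1 -> glue s = mid_rep s *m k - k *m frob_rep s.
  move=> ds; have us := det_unit1 ds.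
  have V : frob_rep (invmx s) *m frob_rep s = 1%:M by rewrite -frob_repM mulVmx ?frob_rep1.
  have := congr1 (mulmx^~ (frob_rep s)) (H s ds).
  by rewrite /twist mulmxBl -!mulmxA V !mulmx1.
(* The weights of middle monomials and of [x^p], [y^p] under [diag(t, 1/t)] have ratios [t^(2j)]
   with [0 < j < p], up to inversion; such a [t] separates them and forces [k = 0]. *)
have [t t0 tN] : exists2 t : K, t != 0 & forall j, (0 < j < r.+2)%N -> t ^+ (2 * j) != 1.
  pose q : {poly K} := 'X * \prod_(j < r.+1) ('X^(2 * j.+1) - 1).
  have /closed_nonrootP[t] : q != 0.
    rewrite mulf_neq0 ?polyX_eq0 //; apply/prodf_neq0 => j _.
    by rewrite -size_poly_gt0 size_XnsubC // muln_gt0.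
  rewrite rootM rootX negb_or => /andP[t0 Ht]; exists t => // j /andP[j0 jr].
  apply: contra Ht => /eqP tj; rewrite rootE horner_prod; apply/eqP.
  case: j j0 jr tj => // j _ jr tj.
  by rewrite (bigD1 (Ordinal (jr : (j < r.+1)%N))) //= !hornerE tj subrr mul0r.
pose d := mx22 t 0 0 t^-1.
have dd : \det d = 1 by rewrite det22 !mxE /= mulr0 subr0 mulfV.
have diagd : is_diag_mx d.
  by apply/is_diag_mxP => a b; rewrite mxE; case: (ord2P a) (ord2P b) => -> [] ->.
have Bd (i : 'I_r.+2) : bin_act r.+1 d i i = t ^+ i / t ^+ (r.+1 - i).
  rewrite mxE !mxE /= scale0r add0r addr0 exprZn -rmorphXn /= coefMC coefZ coefXn eqxx mulr1.
  by rewrite exprVn.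
have k0 : k = 0.
  apply/matrixP => i j; rewrite [in RHS]mxE; apply/eqP/negPn/negP => kij.
  have Eij : glue d i j = (mid_rep d *m k) i j - (k *m frob_rep d) i j.
    by rewrite (Hg d dd) [LHS]mxE; congr (_ + _); rewrite mxE.
  move: Eij; rewrite [glue d i j]mxE (bin_act_diag_entry diagd) 1?eq_sym ?eps_mid //.
  rewrite [(_ *m k) i j]mxE [(k *m _) i j]mxE (bigD1 i) //= big1 => [|l li]; last first.
    by rewrite [X in X * _]mxE (bin_act_diag_entry diagd) ?mul0r // (inj_eq mid_inj) eq_sym.
  rewrite [X in _ - X](bigD1 j) //= [X in _ - (_ + X)]big1 => [|l lj]; last first.
    by rewrite [X in _ * X]mxE (bin_act_diag_entry diagd) ?mulr0 // (inj_eq eps_inj).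
  rewrite !addr0 [mid_rep d i i]mxE [frob_rep d j j]mxE !Bd => /esym/eqP.
  rewrite [k i j * _]mulrC -mulrBl mulf_eq0 (negPf kij) orbF subr_eq0.
  have mi : (mid i : nat) = i.+1 by [].
  rewrite mi /eps; case: (ord2P j) => -> /=.
    rewrite /bump add1n subnn expr0 divr1 subSS => /eqP E.
    have mr : (0 < r - i < r.+2)%N by rewrite subn_gt0 ltn_ord /=; lia.
    have /negP := tN _ mr; apply; apply/eqP; apply: (mulfI (expf_neq0 i.+1 t0)).
    rewrite mulr1 mul2n -addnn exprD mulrA -exprD addSn subnKC ?(ltnW (ltn_ord i)) //.
    by rewrite -E divfK ?expf_neq0.
  rewrite subn0 expr0 subSS => /eqP E.
  have /negP := tN i.+1 (ltn_ord (mid i)); apply; apply/eqP.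
  rewrite mul2n -addnn exprD -[X in X * _](divfK (expf_neq0 (r - i) t0)) E -mulrA -exprD addnS.
  by rewrite subnK ?(ltnW (ltn_ord i)) // divfK ?expf_neq0.
have d1 : \det (mx22 (1 : K) 1 0 1) = 1 by rewrite det22 !mxE /= mulr0 subr0 mulr1.
have := congr1 (fun M : 'M_(r, 2) => M (Ordinal r0) 1) (Hg _ d1).
rewrite k0 mulmx0 mul0mx subr0 !mxE /= scale0r add0r scale1r /bump /= expr1n mulr1 expr1.
by rewrite coefD coefX coefC add0r => /eqP; rewrite oner_eq0.
Qed.

End SymmetricPower.

(** The count is [2 + r + 3 (2 r + 1)], with [r = p - 1]. *)
Lemma card_example r :
  #|{: 'I_2 + 'I_r + 'I_3 * option ('I_r * 'I_2)}| = (7 * r.+1 - 2)%N.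
Proof. by rewrite card_sum card_sum card_prod card_option card_prod !card_ord; lia. Qed.

(** * The module V and its annihilated cocycle *)

Section Example.

Variables (K : closedFieldType) (r : nat) (G : 'M[K]_2 -> Prop).
Hypotheses (charK : r.+1 \in [pchar K]) (closedG : closed_subgroup_GL G).
Hypothesis SL2G : forall s : 'M[K]_2, \det s = 1 -> G s.

Let A (s : 'M[K]_2) (i j : 'I_r) : K := mid_rep r s i j.
Let F (s : 'M[K]_2) (i j : 'I_2) : K := frob_rep r s i j.
Let T (s : 'M[K]_2) (ij : 'I_r * 'I_2) : K := twist r s ij.1 ij.2.

(* Indices of the coordinates on V; [None] stands for the projection M -> K. *)
Let W : finType := option ('I_r * 'I_2).
Let I : finType := ('I_2 + 'I_r + 'I_3 * W)%type.

(** Hom(F, A) is realized as the tensor product of A with the dual of F, and [T] is its extension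
    cocycle. *)
Let extension := rep_ext (rep_tensor A (rep_dual F)) T.
Let V := rep_sum (rep_sum F (rep_dual A)) (@rep_copies K 'I_3 W extension).

Let weight_rep_V : weight_rep G V.
Proof.
have [wA wF] := (weight_rep_mid charK closedG, weight_rep_frob charK closedG).
apply: weight_rep_sum; first exact: weight_rep_sum wF (weight_rep_dual closedG wA).
apply/weight_rep_copies/weight_rep_ext.
- exact: weight_rep_tensor wA (weight_rep_dual closedG wF).
- by move=> i; rewrite /T twist1 mxE.
- move=> s t [i j] Gs Gt; rewrite /T (twistM charK closedG Gs Gt) mxE; congr (_ + _).
  rewrite -(pair_bigA _ (fun k l => rep_tensor A (rep_dual F) s (i, j) (k, l) * twist r t k l)) /=.
  rewrite mxE exchange_big /=; apply: eq_bigr => l _; rewrite mxE mulr_suml.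
  by apply: eq_bigr => k _; rewrite /rep_tensor /= mulrAC.
- by move=> i; apply: regular_twist.
- by move=> t i _ dt; rewrite /T twist_diag // mxE.
Qed.

Let n := #|I|.
Let rho : 'M[K]_2 -> 'M[K]_n := rep_mx V.
Local Notation S := {mpoly K[n]}.
Local Notation act := (poly_act rho).
Local Notation C := (map_mx (@mpolyC n K)).

Let X (e : I) : S := 'X_(enum_rank e).

Let actX s e : act s (X e) = \sum_e' V (invmx s) e e' *: X e'.
Proof.
rewrite /X poly_actX -[RHS]sum_enum_val; apply: eq_bigr => i _.
by rewrite mxE enum_rankK enum_valK.
Qed.

(** The coordinates are arranged as generic points of F, of the dual of A and of three copies of
    Hom(F, A), so that matrix products express the natural pairings. *)
Let mu : 'cV[S]_2 := \col_j X (inl (inl j)).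
Let la : 'rV[S]_r := \row_i X (inl (inr i)).
Let ps k : 'M[S]_(r, 2) := \matrix_(i, j) X (inr (k, Some (i, j))).
Let a k : S := X (inr (k, None)).

Let act_mu s : map_mx (act s) mu = C (frob_rep r (invmx s)) *m mu.
Proof.
apply/colP => j; rewrite [LHS]mxE [mu _ _]mxE [RHS]mxE actX big_sumType /= [X in _ + X]big1 => [|e _]; last exact: scale0r.
rewrite addr0 big_sumType /= [X in _ + X]big1 => [|e _]; last exact: scale0r.
by rewrite addr0; apply: eq_bigr => l _; rewrite [C _ _ _]mxE mul_mpolyC [mu _ _]mxE.
Qed.

Let act_la s : map_mx (act s) la = la *m C (mid_rep r s).
Proof.
apply/rowP => j; rewrite [LHS]mxE [la _ _]mxE [RHS]mxE actX big_sumType /= [X in _ + X]big1 => [|e _]; last exact: scale0r.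
rewrite addr0 big_sumType /= [X in X + _]big1 => [|e _]; last exact: scale0r.
rewrite add0r; apply: eq_bigr => l _.
by rewrite [C _ _ _]mxE mulrC mul_mpolyC [la _ _]mxE /rep_dual invmxK.
Qed.

Let act_copy s k (o : W) :
  act s (X (inr (k, o))) = \sum_o' extension (invmx s) o o' *: X (inr (k, o')).
Proof.
rewrite actX big_sumType /= [X in X + _]big1 => [|e _]; last exact: scale0r.
rewrite add0r.
pose H k' o' := rep_copies extension (invmx s) (k, o) (k', o') *: X (inr (k', o')).
rewrite (eq_bigr (fun e => H e.1 e.2)) => [|[] //]; rewrite -(pair_bigA _ H) /= (bigD1 k) //= [X in _ + X]big1 => [|k' k'k].
  by rewrite addr0; apply: eq_bigr => o' _; rewrite /H /rep_copies /= eqxx mul1r.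
by rewrite big1 // => o' _; rewrite /H /rep_copies /= eq_sym (negPf k'k) mul0r scale0r.
Qed.

Let act_a s k : act s (a k) = a k.
Proof.
rewrite /a act_copy (bigD1 None) //= scale1r big1 ?addr0 // => -[o _|//].
by rewrite scale0r.
Qed.

Let act_ps s k : map_mx (act s) (ps k) =
  C (mid_rep r (invmx s)) *m ps k *m C (frob_rep r s) + a k *: C (twist r (invmx s)).
Proof.
apply/matrixP => i j; rewrite 2![in LHS]mxE act_copy (bigD1 None) //= addrC.
rewrite [RHS]mxE; congr (_ + _); last first.
  by rewrite [RHS]mxE [C _ _ _]mxE mulrC mul_mpolyC.
rewrite (reindex_omap Some id) => [|[]] //=.
rewrite (eq_bigl predT) => [|o]; last by rewrite eqxx.
pose H k' l := (A (invmx s) i k' * F (invmx (invmx s)) l j) *: X (inr (k, Some (k', l))).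
rewrite (eq_bigr (fun e => H e.1 e.2)) => [|[] //]; rewrite -(pair_bigA _ H) /= exchange_big [RHS]mxE; apply: eq_bigr => l _.
rewrite [X in _ = X * _]mxE mulr_suml; apply: eq_bigr => k' _.
rewrite /H invmxK [C _ i k']mxE [ps k k' l]mxE [C _ l j]mxE mulrAC -rmorphM /=.
by rewrite mul_mpolyC.
Qed.

Let g (s : 'M[K]_2) : S := (la *m C (twist r s) *m mu) 0 0.
Let b k : S := - (la *m ps k *m mu) 0 0.

Let act_entry s (M : 'M[S]_1) : act s (M 0 0) = (map_mx (act s) M) 0 0.
Proof. by rewrite mxE. Qed.

Let actC s k l (M : 'M[K]_(k, l)) : map_mx (act s) (C M) = C M.
Proof. by apply/matrixP => i j; rewrite !mxE poly_actC. Qed.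

Let cocycle_g s t : G s -> G t -> g (s *m t) = act s (g t) + g s.
Proof.
move=> Gs Gt; rewrite /g (twistM charK closedG Gs Gt) act_entry.
move: (twist r s) (twist r t) => u w.
rewrite !map_mxM act_la act_mu actC map_mxD !map_mxM mulmxDr mulmxDl mxE addrC.
by rewrite !mulmxA.
Qed.

(** The action adds [a k] times [twist r (invmx s)] to [ps k]. The pairing is otherwise invariant,
    and by [twistV] the added term contributes [- a k * g s]; this explains the sign in [b]. *)
Let annihilate k s : G s -> a k * g s = act s (b k) - b k.
Proof.
move=> Gs; have Gi : G (invmx s) by case: closedG => _ _ _; apply.
have := twistV charK closedG Gs; have Vm := mid_repV charK closedG Gs.
have Vf := frob_repV charK closedG Gs.
rewrite /b /g; move: (twist r s) => u Hu.
rewrite rmorphN /= opprK act_entry !map_mxM act_la act_mu act_ps.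
move: (twist r (invmx s)) Hu => w Hw.
rewrite mulmxDr mulmxDl -!mulmxA (mulmxA (C (mid_rep r s))) -map_mxM Vm map_mx1 mul1mx.
rewrite (mulmxA (C (frob_rep r s))) -map_mxM Vf map_mx1 mul1mx.
rewrite -scalemxAl -!scalemxAr [in RHS]mxE opprD addrAC addNr add0r [in RHS]mxE.
rewrite (mulmxA (C w)) -map_mxM (mulmxA (C (mid_rep r s))) -map_mxM.
rewrite (mulmxA (mid_rep r s) w) Hw.
by rewrite map_mxN mulNmx mulmxN [X in _ = - (_ * X)]mxE mulrN opprK mulmxA.
Qed.

Let lai i : I := inl (inr i).
Let muj j : I := inl (inl j).

Let gE s : g s = \sum_i \sum_j twist r s i j *: (X (lai i) * X (muj j)).
Proof.
rewrite /g mxE exchange_big; apply: eq_bigr => j _; rewrite mxE mulr_suml.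
apply: eq_bigr => i _; rewrite [la _ _]mxE [C _ _ _]mxE [mu _ _]mxE mulrAC mulrC.
exact: mul_mpolyC.
Qed.

Let g_homog s : g s \is 2.-homog.
Proof.
rewrite gE; apply: rpred_sum => i _; apply: rpred_sum => j _; apply: rpredZ.
by rewrite /X -mpolyXD dhomogX /= mdegD !mdeg1.
Qed.

Let cocycle_deg_g : cocycle_deg G rho 2 g.
Proof.
split=> [|s _]; last exact: g_homog; split; last exact: cocycle_g.
split=> [|m].
  exists 3%N => s _; rewrite msizeE; apply/bigmax_leqP_seq => m mg _.
  by have /dhomogP/(_ m mg) /= -> := g_homog s.
apply: (@regular_eq _ _ _ (fun s => \sum_i \sum_j twist r s i j * (X (lai i) * X (muj j))@_m)).
  move=> s _; rewrite gE (raddf_sum (mcoeff m)); apply: eq_bigr => i _ /=.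
  by rewrite (raddf_sum (mcoeff m)); apply: eq_bigr => j _; rewrite /= mcoeffZ.
do 2 apply: (regular_sum closedG) => ?.
by apply: regularM; [exact: regular_twist | exact: regular_const].
Qed.

Let hessian_g s i j : hessian (g s) (enum_rank (lai i)) (enum_rank (muj j)) = twist r s i j.
Proof.
have ne k l : (enum_rank (lai k) == enum_rank (muj l)) = false by rewrite (inj_eq enum_rank_inj).
rewrite hessianE ?ne // gE (raddf_sum (mcoeff _)) (bigD1 i) //= (raddf_sum (mcoeff _)) (bigD1 j) //=.
have co k l : (X (lai k) * X (muj l))@_(U_(enum_rank (lai i)) + U_(enum_rank (muj j)))
    = ((k == i) && (l == j))%:R.
  rewrite /X -mpolyXD mcoeffX; congr (_%:R); congr nat_of_bool; apply/eqP/andP => [E|[/eqP-> /eqP->//]].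
  have Ei := congr1 (fun m : 'X_{1..n} => m (enum_rank (lai i))) E.
  have Ej := congr1 (fun m : 'X_{1..n} => m (enum_rank (muj j))) E.
  move: Ei Ej; rewrite !mnmDE !mnm1E !eqxx ![enum_rank (muj _) == enum_rank (lai _)]eq_sym !ne.
  rewrite !(inj_eq enum_rank_inj) !(addn0, add0n).
  rewrite -[k == i]/(lai k == lai i) -[l == j]/(muj l == muj j).
  by do 2!case: eqP.
rewrite mcoeffZ co !eqxx mulr1 !big1 ?addr0 // => [k ki|l lj].
  by rewrite (raddf_sum (mcoeff _)) big1 // => l _; rewrite /= mcoeffZ co (negPf ki) mulr0.
by rewrite mcoeffZ co eqxx (negPf lj) mulr0.
Qed.

Let sum_la s i (Phi : 'I_n -> K) : \sum_e rho (invmx s) e (enum_rank (lai i)) * Phi e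
  = \sum_i' mid_rep r s i i' * Phi (enum_rank (lai i')).
Proof.
transitivity (\sum_e V (invmx s) e (lai i) * Phi (enum_rank e)).
  rewrite -[RHS]sum_enum_val; apply: eq_bigr => e _.
  by rewrite mxE enum_rankK enum_valK.
rewrite big_sumType /= [X in _ + X]big1 => [|e _]; last exact: mul0r.
rewrite addr0 big_sumType /= [X in X + _]big1 => [|e _]; last exact: mul0r.
by rewrite add0r; apply: eq_bigr => i' _; rewrite /rep_dual invmxK.
Qed.

Let sum_mu s j (Phi : 'I_n -> K) : \sum_e rho (invmx s) e (enum_rank (muj j)) * Phi e
  = \sum_j' frob_rep r (invmx s) j' j * Phi (enum_rank (muj j')).
Proof.
transitivity (\sum_e V (invmx s) e (muj j) * Phi (enum_rank e)).
  rewrite -[RHS]sum_enum_val; apply: eq_bigr => e _.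
  by rewrite mxE enum_rankK enum_valK.
rewrite big_sumType /= [X in _ + X]big1 => [|e _]; last exact: mul0r.
by rewrite addr0 big_sumType /= [X in _ + X]big1 ?addr0 // => e _; exact: mul0r.
Qed.

(** The mixed second derivatives of [v] in the coordinates [la] and [mu] form a matrix whose
    coboundary would be [twist]. *)
Let g_not_coboundary : (0 < r)%N -> ~ coboundary G rho g.
Proof.
move=> r0 [v Hv].
pose k : 'M[K]_(r, 2) := \matrix_(i, j) hessian v (enum_rank (lai i)) (enum_rank (muj j)).
apply: (twist_not_coboundary charK (k := k) r0) => s ds; have Gs := SL2G ds.
apply/matrixP => i j; rewrite -hessian_g Hv // [RHS]mxE.
have -> (f h : S) c d : hessian (f - h) c d = hessian f c d - hessian h c d.
  by rewrite /hessian !mderivB mcoeffB.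
rewrite [(- k) i j]mxE [k i j]mxE; congr (_ - _); rewrite hessian_act.
under eq_bigr do rewrite -mulr_sumr sum_mu.
rewrite sum_la mxE; under [RHS]eq_bigr do rewrite mxE mulr_suml.
rewrite exchange_big; apply: eq_bigr => i' _; rewrite mulr_sumr; apply: eq_bigr => j' _.
by rewrite [k _ _]mxE [frob_rep _ _ _ _ * _]mulrC mulrA.
Qed.

Let v (k : 'I_3) : 'I_n := enum_rank (inr (k, None) : I).

Let v_inj : injective v.
Proof. by move=> k k' /enum_rank_inj [->]. Qed.

Lemma example_non_cm : exists rho : 'M[K]_2 -> 'M[K]_n,
  [/\ Gmodule G rho, ~ cohen_macaulay (invariant_ring G rho)
    & exists (g : 'M[K]_2 -> S) (a : 3.-tuple S),
      [/\ cocycle_deg G rho 2 g, ~ coboundary G rho g, partial_hsop (fun _ => True) a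
        & forall i, [/\ tnth a i \is 1.-homog, invariant_ring G rho (tnth a i)
                      & coboundary G rho (fun s => tnth a i * g s)]]].
Proof.
have r0 : (0 < r)%N by case/andP: charK => /prime_gt1.
have ncob := g_not_coboundary r0.
have Rv k : invariant_ring G rho 'X_(v k) by move=> s _; apply: act_a.
have modV : Gmodule G rho := Gmodule_rep_mx weight_rep_V.
have diagV t : G t -> is_diag_mx t -> is_diag_mx (rho t).
  by move=> Gt dt; apply: is_diag_rep_mx weight_rep_V Gt dt.
have ncm := annihilated_cocycle_not_cm charK closedG SL2G modV diagV v_inj Rv annihilate ncob.
exists rho; split=> //.
exists g, [tuple of map (fun i => 'X_i : S) [tuple v k | k < 3]].
have aE i : tnth [tuple of map (fun i => 'X_i : S) [tuple v k | k < 3]] i = 'X_(v i).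
  by rewrite tnth_map tnth_mktuple.
split=> // [|i].
  by apply: vars_partial_hsop; rewrite map_inj_uniq ?enum_uniq.
rewrite aE; split=> //; first by rewrite dhomogX /= mdeg1.
by exists (b i) => s Gs; apply: annihilate.
Qed.

End Example.

Theorem mainTheorem1 (K : closedFieldType) (p : nat) (G : 'M[K]_2 -> Prop)
    (charKp : p \in [pchar K])
    (closedG : closed_subgroup_GL G)
    (redG : reductive G)
    (SL2G : forall s : 'M[K]_2, \det s = 1 -> G s) :
  exists rho : 'M[K]_2 -> 'M[K]_(7 * p - 2),
    [/\ Gmodule G rho,
        ~ cohen_macaulay (invariant_ring G rho)
      & exists (g : 'M[K]_2 -> {mpoly K[7 * p - 2]})
               (a : 3.-tuple {mpoly K[7 * p - 2]}),
          [/\ cocycle_deg G rho 2 g,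
              ~ coboundary G rho g,
              partial_hsop (fun _ => True) a
            & forall i, [/\ tnth a i \is 1.-homog,
                            invariant_ring G rho (tnth a i)
                          & coboundary G rho (fun s => tnth a i * g s)]]].
Proof.
case: p charKp => [|r] charKp; first by case/andP: charKp.
by rewrite -(card_example r); apply: example_non_cm.
Qed.
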